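(* Every satisfiable $\mathbf F_q,\mathbf G_1$-formula $\phi$ has a model of height at most $|\phi|$.
   Context: Fix a finite set $\mathcal A$ of atomic propositions. A Markov chain is $M=(S,P,s_0,L)$ with $S$ countable, $P:S\times S\to[0,1]$, $\sum_tP(s,t)=1$ for all $s$, initial state $s_0$, labeling $L:S\to2^{\mathcal A}$. $\mathbb P_{M(s)}$ is the standard probability measure on runs from $s$; $\pi[i]$ is the $i$-th state of run $\pi$. PCTL$(\mathbf F,\mathbf G)$ formulae: $a,\neg a$ ($a\in\mathcal A$), $\wedge,\vee$, $\mathbf F_{\rhd q}\varphi$, $\mathbf G_{\rhd q}\varphi$ ($\rhd\in\{\ge,>\}$, $q\in[0,1]\cap\mathbb Q$), with $M,s\models\mathbf F_{\rhd q}\varphi$ iff $\mathbb P_{M(s)}(\{\pi\mid\exists i: M,\pi[i]\models\varphi\})\rhd q$ and $M,s\models\mathbf G_{\rhd q}\varphi$ iff $\mathbb P_{M(s)}(\{\pi\mid\forall i:M,\pi[i]\models\varphi\})\rhd q$; literals via $L$, Boolean connectives as usual. $=1$ means $\ge1$. $M$ is a model of $\phi$ if $M,s_0\models\phi$; $\phi$ is satisfiable if it has a (countable) model. $|\phi|$ is the length of $\phi$. An $\mathbf F_q,\mathbf G_1$-formula is given by $\Phi::=a\mid\neg a\mid\Phi\wedge\Phi\mid\mathbf F_{\rhd q}\Phi\mid\mathbf G_{=1}\Phi$. A Markov chain has height $h$ if its transition graph (edges $s\to t$ with $P(s,t)>0$) is a tree rooted at $s_0$ of height $h$ together with additional back edges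 (edges from a node to one of its ancestors or to itself). *)

(* Defs.v *)
From HB Require Import structures.
From mathcomp Require Import all_boot all_order all_algebra.
From mathcomp Require Import all_classical all_reals all_analysis.

Set Implicit Arguments.
Unset Strict Implicit.
Unset Printing Implicit Defensive.

Import Order.TTheory GRing.Theory Num.Theory.
Import numFieldNormedType.Exports.

Local Open Scope classical_set_scope.
Local Open Scope ring_scope.

Record markov_chain (R : realType) (AP : finType) := MarkovChain {
  state :> countType;
  trans : state -> state -> R;
  init : state;
  label : state -> {set AP};
  trans_itv : forall s t, 0 <= trans s t <= 1;
  trans_sum1 : forall s, (\esum_(t in [set: state]) (trans s t)%:E = 1)%E
}.

Section runs.
Context {R : realType} {AP : finType} (M : markov_chain R AP).

Definition run := nat -> M.

HB.instance Definition _ := gen_eqMixin run.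
HB.instance Definition _ := gen_choiceMixin run.
HB.instance Definition _ := isPointed.Build run (fun=> init M).

Definition cylinder (w : seq M) : set run := [set pi | mkseq pi (size w) = w].

Definition cylinders : set (set run) := range cylinder.

Fixpoint steps_prob (s : M) (w : seq M) : R :=
  if w is t :: w' then trans s t * steps_prob t w' else 1.

Definition cylinder_prob (s : M) (w : seq M) : R :=
  if w is t :: w' then (t == s)%:R * steps_prob t w' else 1.

(* The sample space is all of S^N: sequences not starting in s or using a
   transition of probability 0 lie in null cylinders. *)
Definition is_run_measure (s : M)
    (mu : probability (g_sigma_algebraType cylinders) R) :=
  forall w, mu (cylinder w) = (cylinder_prob s w)%:E.

End runs.
Arguments cylinders {R AP} M.

Section esum_extra.
Local Open Scope ereal_scope.
Context {R : realType}.

Lemma sub_esum (T : choiceType) (I J : set T) (a : T -> \bar R) : I `<=` J ->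
  \esum_(i in I) a i <= \esum_(i in J) a i.
Proof.
move=> IJ; apply: ereal_sup_le => _ /= [X [fX XI] <-].
by exists X => //; split => //; exact: subset_trans IJ.
Qed.

Lemma le_esum_bigcup (I T : choiceType) (J : set I) (K : I -> set T)
    (a : T -> \bar R) : (forall t, 0 <= a t) ->
  \esum_(t in \bigcup_(i in J) K i) a t <=
  \esum_(i in J) \esum_(t in K i) a t.
Proof.
move=> a0; rewrite esum_esum//.
have /choice[f fP] : forall t, exists i : option I,
    (\bigcup_(i in J) K i) t -> exists2 j, i = Some j & J j /\ K j t.
  move=> t; have [[i Ji Kit]|] := pselect ((\bigcup_(i in J) K i) t).
    by exists (Some i) => _; exists i.
  by move=> nt; exists None.
rewrite [leLHS](_ : _ = \esum_(k in [set k : I * T |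
    (\bigcup_(i in J) K i) k.2 /\ f k.2 = Some k.1]) a k.2).
  apply: sub_esum => -[i t] /= [/fP[j -> [Jj Kj]] [<-]]; split => //.
apply: reindex_esum; split.
- by move=> [i t] [].
- move=> [i t] [j t'] /=; rewrite !inE/= => -[_ fi] [_ fj] tt'.
  by move: fi; rewrite tt' fj => -[->].
- by move=> t Ut; have [j ft [Jj Kj]] := fP _ Ut; exists (j, t).
Qed.

Lemma esum_bigcup_triv (I T : choiceType) (J : set I) (K : I -> set T)
    (a : T -> \bar R) : (forall t, 0 <= a t) -> trivIset setT K ->
  \esum_(i in J) \esum_(t in K i) a t =
  \esum_(t in \bigcup_(i in J) K i) a t.
Proof.
move=> a0 tK; rewrite esum_esum//; apply/esym/reindex_esum; split.
- by move=> [/= i j] [Ki Jij]; exists i.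
- move=> [/= i1 j1] [/= i2 j2]; rewrite ?inE/=.
  move=> [K1 J1] [K2 J2] j12; congr (_, _) => //.
  by apply: (@tK i1 i2) => //; exists j1; split=> //; rewrite j12.
- by move=> j [i Ki Jij]/=; exists (i, j).
Qed.

Lemma esumZl (T : choiceType) (I : set T) (a : T -> \bar R) (c : R) :
  (0 <= c)%R -> (forall t, 0 <= a t) ->
  \esum_(i in I) (c%:E * a i) = c%:E * \esum_(i in I) a i.
Proof.
have le_Z (b : T -> \bar R) (d : R) : (0 <= d)%R -> (forall t, 0 <= b t) ->
    \esum_(i in I) (d%:E * b i) <= d%:E * \esum_(i in I) b i.
  move=> d0 b0; apply: ge_ereal_sup => _ [X [fX XI] <-].
  rewrite -ge0_mule_fsumr//; apply: lee_wpmul2l; first by rewrite lee_fin.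
  by apply: ereal_sup_ubound; exists X.
move=> c0 a0; apply/eqP; rewrite eq_le le_Z//=.
have [->|cn0] := eqVneq c 0%R.
  by rewrite mul0e; apply: esum_ge0 => i _; rewrite mul0e.
have cgt0 : (0 < c)%R by rewrite lt_neqAle eq_sym cn0.
have ca0 t : 0 <= c%:E * a t by rewrite mule_ge0.
have ci0 : (0 <= c^-1)%R by rewrite invr_ge0.
have := le_Z _ _ ci0 ca0.
under eq_esum do rewrite muleA -EFinM mulVf// mul1e.
by rewrite -(@lee_pmul2l _ c%:E) ?lte_fin// muleA -EFinM mulfV// mul1e.
Qed.

End esum_extra.

(* The measure on runs is the Caratheodory extension of cylinder_prob. *)
Section run_measure_existence.
Local Open Scope ereal_scope.
Context {R : realType} {AP : finType} (M : markov_chain R AP) (s : M).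
Implicit Types (w u v : seq M) (W : set (seq M)) (X : set (run M)).

Let wt w : \bar R := (cylinder_prob s w)%:E.

Let next w (t : M) : R := if w is x :: w' then trans (last x w') t
  else (t == s)%:R.

Let next_ge0 w t : (0 <= next w t)%R.
Proof. by case: w => //= x w; case/andP: (trans_itv (last x w) t). Qed.

Let next_le1 w t : (next w t <= 1)%R.
Proof.
case: w => /= [|x w]; first by case: eqP.
by case/andP: (trans_itv (last x w) t).
Qed.

Let steps_prob_rcons (x : M) w t :
  steps_prob x (rcons w t) = (steps_prob x w * trans (last x w) t)%R.
Proof. by elim: w x => [|y w ih] x /=; rewrite ?mulr1 ?mul1r// ih mulrA. Qed.

Let wt_rcons w t : wt (rcons w t) = (next w t)%:E * wt w.
Proof.
rewrite /wt -EFinM; congr EFin; case: w => [|x w] /=; first by rewrite !mulr1.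
by rewrite steps_prob_rcons mulrA mulrC.
Qed.

Let wt_ge0 w : 0 <= wt w.
Proof.
elim/last_ind: w => [|w t ih]; first by rewrite lee_fin.
by rewrite wt_rcons mule_ge0// lee_fin.
Qed.

Let esum_next w : \esum_(t in [set: M]) (next w t)%:E = 1.
Proof.
case: w => [|x w] /=; last exact: trans_sum1.
rewrite (esumID [set s])//= setTI esum_set1 ?eqxx// esum1 ?adde0//.
by move=> i [_ /= /eqP/negPf ->].
Qed.

Let esum_wt_rcons w : \esum_(t in [set: M]) wt (rcons w t) = wt w.
Proof.
under eq_esum do rewrite wt_rcons muleC.
rewrite esumZl ?esum_next ?mule1 -?lee_fin//; first exact: wt_ge0.
by move=> t; rewrite lee_fin.
Qed.

Let wt_prefix u v : prefix u v -> wt v <= wt u.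
Proof.
move=> /prefixP[w ->]; elim/last_ind: w => [|w t ih]; first by rewrite cats0.
rewrite -rcons_cat wt_rcons; apply: le_trans ih.
by rewrite -[leRHS]mul1e lee_wpmul2r// lee_fin.
Qed.

Let cyl_prefix (pi : run M) n u : cylinder u pi -> (size u <= n)%N ->
  prefix u (mkseq pi n).
Proof.
move=> <-; rewrite size_mkseq => un; rewrite prefixE size_mkseq /mkseq.
by rewrite -map_take take_iota (minn_idPl un).
Qed.

Let prefix_cyl (pi : run M) n u : prefix u (mkseq pi n) -> cylinder u pi.
Proof.
move=> pu; have un := size_prefix pu; rewrite size_mkseq in un.
move: pu; rewrite prefixE => /eqP; rewrite /mkseq -map_take take_iota.
by rewrite (minn_idPl un).
Qed.

Let cover W := \bigcup_(w in W) @cylinder R AP M w.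

Let wt_cover w W : cylinder w `<=` cover W -> wt w <= \esum_(u in W) wt u.
Proof.
move=> wW; rewrite leNgt; apply/negP => lt_W.
pose c v := \esum_(u in W `&` [set u | prefix v u]) wt u.
have /choice[nxt nxtP] v : exists t, c v < wt v -> c (rcons v t) < wt (rcons v t).
  apply/not_existsP => H; have cv : c v < wt v.
    by have /not_implyP[] := H (init M).
  have {}H t : wt (rcons v t) <= c (rcons v t).
    by have /not_implyP[_ /negP] := H t; rewrite -leNgt.
  move: cv; apply/negP; rewrite -leNgt -esum_wt_rcons.
  apply: (le_trans (le_esum (fun t _ => H t))); rewrite esum_bigcup_triv//.
    apply: sub_esum => u [t _ [Wu /= vu]]; split => //=.
    exact: prefix_trans (prefix_rcons _ _) vu.
  apply/trivIsetP => t t' _ _ tt'; rewrite -subset0 => u [[_ /= tu] [_ /= t'u]].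
  move: tu t'u tt'; rewrite !prefixE !size_rcons => /eqP -> /eqP /rcons_inj[->].
  by rewrite eqxx.
pose V n := iter n (fun v => rcons v (nxt v)) w.
have sV n : size (V n) = (size w + n)%N.
  by elim: n => [|n ih]; rewrite ?addn0//= size_rcons ih addnS.
have cV n : c (V n) < wt (V n).
  elim: n => [|n ih]; last exact: nxtP.
  by apply: le_lt_trans lt_W; apply: sub_esum => u [].
have pV m n : (m <= n)%N -> prefix (V m) (V n).
  move=> /subnK <-; elim: (n - m)%N => [|k ih]; first exact: prefix_refl.
  exact: prefix_trans ih (prefix_rcons _ _).
pose pi : run M := fun i => nth s (V i.+1) i.
have piV n : mkseq pi (size w + n) = V n.
  apply: (@eq_from_nth _ s); first by rewrite size_mkseq sV.
  move=> i; rewrite size_mkseq => iwn; rewrite nth_mkseq// /pi.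
  have [/pV|/ltnW/pV] := leqP i.+1 n => /prefixP[z ->]; rewrite nth_cat sV.
    by rewrite leq_addl.
  by rewrite iwn.
have : cylinder w pi by rewrite /cylinder /= -[size w]addn0 piV.
move=> /wW[u Wu piu].
have [uw|wu] := leqP (size w) (size u).
  have uV : V (size u - size w)%N = u by rewrite -piV subnKC.
  have := cV (size u - size w)%N; rewrite uV; apply/negP; rewrite -leNgt.
  rewrite -[leLHS](esum_set1 (wt_ge0 u)); apply: sub_esum => _ /= ->.
  by split => //=; exact: prefix_refl.
move: lt_W; apply/negP; rewrite -leNgt.
apply: (@le_trans _ _ (wt u)).
  apply: wt_prefix; have := cyl_prefix piu (ltnW wu).
  by rewrite -[in mkseq _ _](addn0 (size w)) piV.
by rewrite -[leLHS](esum_set1 (wt_ge0 u)); apply: sub_esum => _ ->.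
Qed.

Let refine k u := [set v | prefix u v /\ size v = (size u + k)%N].

Let esum_refine k u : \esum_(v in refine k u) wt v <= wt u.
Proof.
elim: k u => [|k ih] u.
  rewrite -[leRHS](esum_set1 (wt_ge0 u)); apply: sub_esum => v [] /=.
  by move=> /prefixP[w ->] /eqP; rewrite size_cat eqn_add2l => /nilP ->; rewrite cats0.
rewrite -[leRHS]esum_wt_rcons; apply: le_trans (le_esum (fun t _ => ih (rcons u t))).
apply: le_trans (le_esum_bigcup _ _ wt_ge0); apply: sub_esum => v [].
move=> /prefixP[[|t w] ->]; first by rewrite cats0 => /eqP; rewrite -[X in X == _]addn0 eqn_add2l.
rewrite size_cat /= => /addnI [wk]; exists t => //; rewrite -cat_rcons; split.
  exact: prefix_prefix.
by rewrite size_cat wk.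
Qed.

Definition run_outer X : \bar R :=
  ereal_inf [set \esum_(w in W) wt w | W in [set W | X `<=` cover W]].

Let run_outer_ge0 X : 0 <= run_outer X.
Proof. by apply: le_ereal_inf_tmp => _ [W _ <-]; exact: esum_ge0. Qed.

Let run_outer_le X W : X `<=` cover W -> run_outer X <= \esum_(w in W) wt w.
Proof. by move=> XW; apply: ereal_inf_lbound; exists W. Qed.

Let run_outer0 : run_outer set0 = 0.
Proof.
apply/eqP; rewrite eq_le run_outer_ge0 andbT -[leRHS](esum_set0 wt).
exact: run_outer_le.
Qed.

Let le_run_outer : {homo run_outer : A B / A `<=` B >-> A <= B}.
Proof.
move=> A B AB; apply: le_ereal_inf_tmp => _ [W BW <-].
by apply: run_outer_le; exact: subset_trans BW.
Qed.

Let run_outer_adherent X (e : R) : (0 < e)%R ->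
  exists2 W, X `<=` cover W & \esum_(w in W) wt w <= run_outer X + e%:E.
Proof.
move=> e0; have : run_outer X <= 1.
  apply: le_trans (_ : run_outer X <= \esum_(w in [set [::]]) wt w) _.
    by apply: run_outer_le => pi _; exists [::].
  by rewrite esum_set1.
move=> Xle1; have Xfin : run_outer X \is a fin_num.
  by rewrite ge0_fin_numE// (le_lt_trans Xle1)// ltry.
have [_ [W XW <-] lt] := lb_ereal_inf_adherent e0 Xfin.
by exists W => //; exact: ltW.
Qed.

Let run_outer_sigma_subadditive : sigma_subadditive run_outer.
Proof.
move=> F; apply/lee_addgt0Pr => e e0.
apply: le_trans (epsilon_trick xpredT _ (ltW e0)); last first.
  by move=> n; exact: run_outer_ge0.
have /choice[W WP] n : exists W, F n `<=` cover W /\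
    \esum_(w in W) wt w <= run_outer (F n) + (e / (2 ^ n.+1)%:R)%:E.
  have en : (0 < e / (2 ^ n.+1)%:R)%R by rewrite divr_gt0// ltr0n expn_gt0.
  by have [W ? ?] := run_outer_adherent (F n) en; exists W.
rewrite nneseries_esumT; last first.
  by move=> n; rewrite adde_ge0// lee_fin divr_ge0// ltW.
apply: le_trans (le_esum (fun n _ => (WP n).2)).
apply: le_trans (le_esum_bigcup _ _ wt_ge0); apply: run_outer_le.
by move=> pi [n _ /(WP n).1[w Ww pw]]; exists w => //; exists n.
Qed.

HB.instance Definition _ := isOuterMeasure.Build R (run M) run_outer
  run_outer0 run_outer_ge0 le_run_outer run_outer_sigma_subadditive.

Let cylinder_caratheodory w : run_outer.-caratheodory (cylinder w).
Proof.
apply: le_caratheodory_measurable => X.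
apply: le_ereal_inf_tmp => _ [W XW <-].
pose W' := \bigcup_(u in W) refine (size w) u.
have XW' : X `<=` cover W'.
  move=> pi /XW[u Wu pu]; exists (mkseq pi (size u + size w)).
    exists u => //; split; last by rewrite size_mkseq.
    by apply: cyl_prefix => //; exact: leq_addr.
  by rewrite /cylinder /= size_mkseq.
apply: (@le_trans _ _ (\esum_(u in W') wt u)); last first.
  apply: le_trans (le_esum_bigcup _ _ wt_ge0) _.
  by apply: le_esum => u _; exact: esum_refine.
have W'size u : W' u -> (size w <= size u)%N.
  by move=> [v _ [_ ->]]; exact: leq_addl.
rewrite (esumID [set u | prefix w u])//; apply: leeD; apply: run_outer_le.
  move=> pi [/XW'[u Wu pu] pw]; exists u => //; split => //=.
  by rewrite -pu; apply: cyl_prefix => //; exact: W'size.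
move=> pi [/XW'[u Wu pu] pw]; exists u => //; split => //= wu.
by apply: pw; apply: (@prefix_cyl _ (size u)); rewrite pu.
Qed.

Let run_outer_cylinder w : run_outer (cylinder w) = wt w.
Proof.
apply/eqP; rewrite eq_le; apply/andP; split.
  rewrite -[leRHS](esum_set1 (wt_ge0 w)); apply: run_outer_le => pi pw.
  by exists w.
by apply: le_ereal_inf_tmp => _ [W /wt_cover wW <-].
Qed.

Definition run_extension : set (g_sigma_algebraType (cylinders M)) -> \bar R :=
  run_outer.

Let sub_run_caratheodory :
  <<s cylinders M >> `<=` run_outer.-cara.-measurable.
Proof.
apply: smallest_sub; last by move=> _ [w _ <-]; exact: cylinder_caratheodory.
exact: (@sigma_algebra_measurable _ (caratheodory_type run_outer)).
Qed.

Let run_extension_sigma_additive : semi_sigma_additive run_extension.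
Proof.
move=> F mF tF mUF; apply: caratheodory_measure_sigma_additive => //.
  by move=> i; exact: (sub_run_caratheodory (mF i)).
exact: sub_run_caratheodory.
Qed.

HB.instance Definition _ := isMeasure.Build _ _ _ run_extension
  run_outer0 run_outer_ge0 run_extension_sigma_additive.

Let run_extension_setT : run_extension setT = 1.
Proof.
rewrite -[RHS](run_outer_cylinder [::]); congr run_outer.
by apply/seteqP; split.
Qed.

HB.instance Definition _ := Measure_isProbability.Build _ _ _ run_extension
  run_extension_setT.

Lemma run_measure_exists :
  exists mu : probability (g_sigma_algebraType (cylinders M)) R,
    is_run_measure s mu.
Proof. by exists run_extension => w; exact: run_outer_cylinder. Qed.

End run_measure_existence.

Definition run_measure {R : realType} {AP : finType} (M : markov_chain R AP)
    (s : M) : probability (g_sigma_algebraType (cylinders M)) R :=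
  sval (cid (run_measure_exists s)).

Lemma run_measureP {R : realType} {AP : finType} (M : markov_chain R AP)
  (s : M) : is_run_measure s (run_measure s).
Proof. exact: svalP (cid (run_measure_exists s)). Qed.

Lemma run_measure_unique {R : realType} {AP : finType} (M : markov_chain R AP)
    (s : M) (mu : probability (g_sigma_algebraType (cylinders M)) R) :
  is_run_measure s mu -> forall A, measurable A -> mu A = run_measure s A.
Proof.
move=> muP A mA; pose G := cylinders M `|` [set set0].
have Gm : G `<=` @measurable _ (g_sigma_algebraType (cylinders M)).
  by move=> B [|->]; [exact: sub_sigma_algebra|exact: measurable0].
have setIG : setI_closed G.
  suff H (u v : seq M) : (size u <= size v)%N -> G (cylinder u `&` cylinder v).
    move=> _ _ [[u _ <-]|->] [[v _ <-]|->];
      rewrite ?setI0 ?set0I; try by right.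
    have [/H//|/ltnW/H] := leqP (size u) (size v).
    by rewrite setIC.
  move=> uv; have [puv|npuv] := eqVneq (take (size u) v) u.
    left; exists v => //; apply/esym/setIidr => pi /= pv.
    rewrite /cylinder /= -[RHS]puv -[in RHS]pv /mkseq -map_take take_iota.
    by rewrite (minn_idPl uv).
  right; apply/seteqP; split => // pi [] /= pu pv; move/eqP: npuv; apply.
  by rewrite -[in LHS]pv /mkseq -map_take take_iota (minn_idPl uv).
apply: (@g_sigma_algebra_measure_unique _ R
  (g_sigma_algebraType (cylinders M)) G Gm (fun=> setT)) => //.
- by move=> _; left; exists [::] => //; apply/seteqP; split.
- by rewrite bigcup_const.
- by move=> B [[w _ <-]|->]; [exact: etrans (muP w) (esym (run_measureP s w))|
    rewrite !measure0].
- by move=> _; rewrite /= probability_setT ltry.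
- by apply: sub_smallest2r mA; [exact: smallest_sigma_algebra|left].
Qed.

Lemma measurable_run_coord {R : realType} {AP : finType}
    (M : markov_chain R AP) (B : set M) (i : nat) :
  @measurable _ (g_sigma_algebraType (cylinders M)) [set pi | B (pi i)].
Proof.
pose C n := if unpickle n is Some w then
  if (size w == i.+1) && `[< B (nth (init M) w i) >] then @cylinder R AP M w
  else set0 else set0.
rewrite (_ : [set pi | _] = \bigcup_n C n); last first.
  apply/seteqP; split => pi /=.
    move=> Bpi; exists (pickle (mkseq pi i.+1)) => //.
    rewrite /C pickleK size_mkseq eqxx nth_mkseq// asboolT//.
    by congr (mkseq pi _); exact: size_mkseq.
  move=> [n _]; rewrite /C; case: unpickle => // w.
  case: ifP => // /andP[/eqP sw /asboolP].
  by move=> + pw; rewrite -pw sw nth_mkseq.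
apply: bigcupT_measurable => n; rewrite /C; case: unpickle => // w.
by case: ifP => // _; apply: sub_sigma_algebra; exists w.
Qed.

Inductive comparison := Ge | Gt.

Definition bound := {q : rat | 0 <= q <= 1}.

Inductive formula (AP : finType) :=
| Atom of AP
| NegAtom of AP
| And of formula AP & formula AP
| Or of formula AP & formula AP
| Finally of comparison & bound & formula AP
| Globally of comparison & bound & formula AP.

Fixpoint FqG1 (AP : finType) (phi : formula AP) : Prop :=
  match phi with
  | Atom _ | NegAtom _ => True
  | And phi1 phi2 => FqG1 phi1 /\ FqG1 phi2
  | Or _ _ => False
  | Finally _ _ psi => FqG1 psi
  | Globally Ge q psi => val q = 1 /\ FqG1 psi
  | Globally Gt _ _ => False
  end.

(* Number of symbols; a temporal operator with its subscript is one symbol. *)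
Fixpoint formula_length (AP : finType) (phi : formula AP) : nat :=
  match phi with
  | Atom _ => 1
  | NegAtom _ => 2
  | And phi1 phi2 | Or phi1 phi2 =>
      (formula_length phi1 + formula_length phi2).+1
  | Finally _ _ psi | Globally _ _ psi => (formula_length psi).+1
  end.

Definition compare {R : realType} (c : comparison) (q : bound) (p : \bar R) :
    Prop :=
  match c with
  | Ge => ((ratr (val q))%:E <= p)%E
  | Gt => ((ratr (val q))%:E < p)%E
  end.

Fixpoint sat {R : realType} {AP : finType} (M : markov_chain R AP)
    (phi : formula AP) (s : M) : Prop :=
  match phi with
  | Atom a => a \in label s
  | NegAtom a => a \notin label s
  | And phi1 phi2 => sat phi1 s /\ sat phi2 s
  | Or phi1 phi2 => sat phi1 s \/ sat phi2 s
  | Finally c q psi =>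
      compare c q (run_measure s [set pi | exists i, sat psi (pi i)])
  | Globally c q psi =>
      compare c q (run_measure s [set pi | forall i, sat psi (pi i)])
  end.

Definition model {R : realType} {AP : finType} (M : markov_chain R AP)
  (phi : formula AP) := sat phi (init M).

Definition satisfiable (R : realType) (AP : finType) (phi : formula AP) :=
  exists M : markov_chain R AP, model M phi.

Section trees.
Variables (T : eqType) (e : rel T).

Definition rooted_tree (r : T) :=
  forall t, exists! p : seq T, path e r p /\ last r p = t.

Definition tree_height (r : T) (h : nat) :=
  (exists2 p, path e r p & size p = h) /\
  (forall p, path e r p -> (size p <= h)%N).

Definition ancestor_or_self (t s : T) := exists2 p, path e t p & last t p = s.

End trees.

Definition has_height {R : realType} {AP : finType} (M : markov_chain R AP)
    (h : nat) :=
  exists e : rel M,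
    [/\ rooted_tree e (init M),
        tree_height e (init M) h,
        forall s t, e s t -> 0 < trans s t &
        forall s t, 0 < trans s t -> e s t \/ ancestor_or_self e t s].

(* Main.v *)
Require Import Defs.
From HB Require Import structures.
From mathcomp Require Import all_boot all_order all_algebra.
From mathcomp Require Import all_classical all_reals all_analysis.
From mathcomp Require Import lra.

(** Let [M] be a model of [phi] with countable state space.  Unravel [M] as
    follows.  A tree node carries a state [s] of [M] and the finite list of
    bodies [chi] of the formulas [F chi] that it still owes; it branches to the
    states [u] at which a run from [s] first satisfies one of these bodies,
    with the corresponding probability.  At [u] the fulfilled bodies are
    replaced by their own [F]-goals, the others are kept, and the first-hit
    decomposition preserves the probability of each [F chi].  Each such step
    uses up an [F] of [phi], so the tree part has bounded height.

    Runs that hit no goal move to a terminal state [t] reachable from [s]: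
    one where no further [G]-subformula of [phi] can become true.  From [t] it
    suffices to build a star whose leaves are the states reachable from [t] and
    return to the centre: whatever is reachable from [t] is reached with
    probability one in the star.  The formulas [F chi] below a [G] hold at all
    nodes because every run ends up in a star. *)

Set Implicit Arguments.
Unset Strict Implicit.
Unset Printing Implicit Defensive.

Import Order.TTheory GRing.Theory Num.Theory.
Import numFieldNormedType.Exports.

Local Open Scope classical_set_scope.
Local Open Scope ring_scope.

(** * Sums over countable types and the first step of a run *)

Section esum_theory.
Local Open Scope ereal_scope.
Context {R : realType}.

Lemma esum_exchange (T1 T2 : choiceType) (a : T1 -> T2 -> \bar R) :
  (forall i j, 0 <= a i j) ->
  \esum_(i in [set: T1]) \esum_(j in [set: T2]) a i j =
  \esum_(j in [set: T2]) \esum_(i in [set: T1]) a i j.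
Proof.
move=> a0; rewrite !esum_esum//.
apply: (@reindex_esum _ _ _ _ _ (fun k : T2 * T1 => (k.2, k.1))
  (fun k : T1 * T2 => a k.1 k.2)); split.
- by move=> [].
- by move=> [i j] [i' j'] _ _ [-> ->].
- by move=> [i j] _; exists (j, i).
Qed.

Lemma esum_range (T1 T2 : choiceType) (g : T1 -> T2) (a : T2 -> \bar R) :
  injective g -> (forall j, 0 <= a j) -> (forall j, ~ range g j -> a j = 0) ->
  \esum_(j in [set: T2]) a j = \esum_(i in [set: T1]) a (g i).
Proof.
move=> g_inj a0 ag; rewrite -(@esum_image _ _ _ setT g); last first.
  by move=> i j _ _; exact: g_inj.
rewrite [RHS]esum_mkcond; apply: eq_esum => j _.
by case: ifPn => // /negP; rewrite inE => /ag.
Qed.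

Lemma esum_single (T : choiceType) (t : T) (a : T -> \bar R) :
  (forall i, 0 <= a i) -> (forall i, i != t -> a i = 0) ->
  \esum_(i in [set: T]) a i = a t.
Proof.
move=> a0 at0; rewrite (esumID [set t])//= setTI esum_set1// esum1 ?adde0//.
by move=> i [_ /= /eqP/at0].
Qed.

Lemma esum_sumtype (T1 T2 : choiceType) (a : T1 + T2 -> \bar R) :
  (forall i, 0 <= a i) ->
  \esum_(i in [set: T1 + T2]) a i =
  \esum_(i in [set: T1]) a (inl i) + \esum_(j in [set: T2]) a (inr j).
Proof.
move=> a0; pose b := fun i : T1 + T2 => if i is inl _ then a i else 0.
pose c := fun i : T1 + T2 => if i is inr _ then a i else 0.
have b0 i : 0 <= b i by case: i => /=.
have c0 i : 0 <= c i by case: i => /=.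
transitivity (\esum_(i in [set: T1 + T2]) (b i + c i)).
  by apply: eq_esum => -[i|i] _ /=; rewrite ?adde0 ?add0e.
rewrite esumD//; congr (_ + _).
- rewrite (esum_range (g := inl))//; first by move=> ? ? [].
  by move=> [i|j] // [] ; exists i.
- rewrite (esum_range (g := inr))//; first by move=> ? ? [].
  by move=> [i|j] // [] ; exists j.
Qed.

Lemma esum_term_le (T : choiceType) (t : T) (a : T -> \bar R) :
  (forall i, 0 <= a i) -> a t <= \esum_(i in [set: T]) a i.
Proof. by move=> a0; rewrite -(esum_set1 (a0 t)); exact: sub_esum. Qed.

(** The weights are [2^-(n+1)] along the enumeration of [T]. They let the centre of a star give
    positive probability to countably many leaves at once. *)
Lemma positive_weights (T : countType) :
  exists2 w : T -> R, (forall t, 0 < w t)%R &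
    \esum_(t in [set: T]) (w t)%:E <= 1.
Proof.
exists (fun t => 1 / (2 ^ (pickle t).+1)%:R)%R.
  by move=> t; rewrite divr_gt0// ltr0n expn_gt0.
have := @epsilon_trick0 R 1%R xpredT ler01; apply: le_trans.
rewrite nneseries_esumT; last first.
  by move=> n; rewrite lee_fin divr_ge0.
rewrite -(@esum_image _ _ _ setT pickle
  (fun n => (1 / (2 ^ n.+1)%:R)%:E)); first exact: sub_esum.
by move=> x y _ _; exact: (pcan_inj pickleK).
Qed.

End esum_theory.

(** * First-step decomposition of the run measure *)

Section one_step.
Local Open Scope ereal_scope.
Context {R : realType} {AP : finType} (M : markov_chain R AP).
Implicit Types (s t : M) (A : set M).

Let runT := g_sigma_algebraType (cylinders M).

Definition cons_run s (pi : run M) : run M :=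
  fun n => if n is n'.+1 then pi n' else s.

(** It suffices to look at generators: the preimage of a cylinder is everything, empty, or the
    cylinder of the tail word. *)
Lemma cons_run_measurable s (X : set (run M)) :
  @measurable _ runT X -> @measurable _ runT (cons_run s @^-1` X).
Proof.
move=> mX; rewrite -[_ @^-1` _]setTI.
have : @measurable_fun _ _ runT runT setT (cons_run s).
  apply: (@measurability _ _ runT runT setT (cons_run s) (cylinders M)) => //.
  move=> _ [_ [w _ <-] <-]; rewrite setTI.
  case: w => [|t w].
    by rewrite (_ : _ @^-1` _ = setT)//; apply/seteqP; split.
  have [<-|ts] := eqVneq s t.
    rewrite (_ : _ @^-1` _ = cylinder w).
      by apply: sub_sigma_algebra; exists w.
    apply/seteqP; split => pi; rewrite /cylinder /= /mkseq /=.
      by case; rewrite (iotaDl 1) -map_comp.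
    by rewrite (iotaDl 1) -map_comp => ->.
  rewrite (_ : _ @^-1` _ = set0)//; apply/seteqP; split => // pi.
  by rewrite /cylinder /= /mkseq /= => -[/eqP]; rewrite (negPf ts).
by apply.
Qed.

Definition step_measure s (X : set runT) : \bar R :=
  \esum_(t in [set: M]) ((trans s t)%:E * run_measure t (cons_run s @^-1` X)).

Let trans_ge0 s t : 0 <= (trans s t)%:E.
Proof. by rewrite lee_fin; case/andP: (trans_itv s t). Qed.

Let step_measure0 s : step_measure s set0 = 0.
Proof. by apply: esum1 => t _; rewrite preimage_set0 measure0 mule0. Qed.

Let step_measure_ge0 s X : 0 <= step_measure s X.
Proof. by apply: esum_ge0 => t _; rewrite mule_ge0. Qed.

(** Each summand is additive, and the sum over successors commutes with the sum over the sets. *)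
Let step_measure_sigma_additive s : semi_sigma_additive (step_measure s).
Proof.
move=> F mF tF mUF.
suff -> : step_measure s (\bigcup_n F n) = \sum_(0 <= i <oo) step_measure s (F i).
  by apply: is_cvg_ereal_nneg_natsum => i _; exact: step_measure_ge0.
rewrite nneseries_esumT// /step_measure esum_exchange; last first.
  by move=> i t; rewrite mule_ge0.
apply: eq_esum => t _; rewrite preimage_bigcup measure_semi_bigcup//.
- rewrite nneseries_esumT// esumZl// -lee_fin; exact: trans_ge0.
- by move=> i; exact: cons_run_measurable.
- apply/trivIsetP => i j _ _ ij; rewrite -preimage_setI.
  by move/trivIsetP : tF => ->//; rewrite preimage_set0.
- by apply: bigcupT_measurable => i; exact: cons_run_measurable.
Qed.

HB.instance Definition _ s := isMeasure.Build _ _ _ (step_measure s)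
  (step_measure0 s) (step_measure_ge0 s) (@step_measure_sigma_additive s).

Let step_measure_setT s : step_measure s setT = 1.
Proof.
rewrite /step_measure -(trans_sum1 s); apply: eq_esum => t _.
by rewrite preimage_setT probability_setT mule1.
Qed.

HB.instance Definition _ s := Measure_isProbability.Build _ _ _
  (step_measure s) (step_measure_setT s).

Let step_measure_cylinder s : is_run_measure s (step_measure s).
Proof.
case=> [|u w].
  rewrite (_ : cylinder _ = setT); last by apply/seteqP; split.
  exact: step_measure_setT.
have consE t : (cons_run s @^-1` cylinder (u :: w)) =
    if u == s then cylinder w else set0.
  apply/seteqP; split => pi; rewrite /cylinder /= /mkseq /=.
    by move=> [<-]; rewrite (iotaDl 1) -map_comp eqxx.
  by case: eqP => // <- /=; rewrite (iotaDl 1) -map_comp => ->.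
rewrite /= /step_measure; under eq_esum => t _ do rewrite consE //.
have [us|us] := eqVneq u s; last first.
  by rewrite mul0r esum1// => t _; rewrite measure0 mule0.
rewrite us mul1r; under eq_esum => t _ do rewrite run_measureP.
case: w {consE} => [|v w] /=.
  by under eq_esum => t _ do rewrite mule1; exact: trans_sum1.
rewrite (esum_single (t := v)).
- by rewrite eqxx mul1r -EFinM.
- move=> t; rewrite mule_ge0// lee_fin mulr_ge0//.
  elim: w v {t} => //= x w ih v; rewrite mulr_ge0//.
  by case/andP: (trans_itv v x).
- by move=> t /negPf; rewrite eq_sym => ->; rewrite mul0r mule0.
Qed.

(** The right-hand side is a probability measure in [X] that agrees with [cylinder_prob s] on
    cylinders, so it is the run measure by uniqueness. *)
Lemma run_measure_step s (X : set runT) : measurable X ->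
  run_measure s X =
  \esum_(t in [set: M]) ((trans s t)%:E * run_measure t (cons_run s @^-1` X)).
Proof.
move=> mX; rewrite -/(step_measure s X).
by rewrite -(run_measure_unique (@step_measure_cylinder s) mX).
Qed.

End one_step.

(** * Reachability probabilities and first hits *)

Section reachability.
Local Open Scope ereal_scope.
Context {R : realType} {AP : finType} {M : markov_chain R AP}.
Implicit Types (s t u v : M) (A B : set M).

Let runT := g_sigma_algebraType (cylinders M).

Definition edge : rel M := fun s t => (0 < trans s t)%R.

Definition reach := ancestor_or_self edge.

Definition reach_prob A s : \bar R :=
  run_measure s [set pi | exists i, A (pi i)].

Lemma trans_ge0 s t : (0 <= trans s t)%R.
Proof. by case/andP: (trans_itv s t). Qed.

Lemma reach_refl s : reach s s.
Proof. by exists [::]. Qed.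

Lemma reach_trans s t u : reach s t -> reach t u -> reach s u.
Proof.
move=> [p ep <-] [p' ep' <-]; exists (p ++ p'); last by rewrite last_cat.
by rewrite cat_path ep.
Qed.

Lemma edge_reach s t : (0 < trans s t)%R -> reach s t.
Proof. by move=> st; exists [:: t] => //=; rewrite andbT. Qed.

Lemma reach_closed (K : set M) s t :
  (forall u v, K u -> (0 < trans u v)%R -> K v) -> reach s t -> K s -> K t.
Proof.
move=> Kc [p + <-]; elim: p s => //= u p ih s /andP[su pu] Ks.
by apply: ih pu _; exact: Kc Ks su.
Qed.

Lemma measurable_finally A :
  @measurable _ runT [set pi | exists i, A (pi i)].
Proof.
rewrite (_ : [set _ | _] = \bigcup_i [set pi | A (pi i)]).
  by apply: bigcupT_measurable => i; exact: measurable_run_coord.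
by apply/seteqP; split => pi /= [i]; [exists i|move=> _; exists i].
Qed.

Lemma reach_prob_ge0 A s : 0 <= reach_prob A s.
Proof. exact: measure_ge0. Qed.

Lemma reach_prob_le1 A s : reach_prob A s <= 1.
Proof. by apply: probability_le1; exact: measurable_finally. Qed.

Hint Resolve reach_prob_ge0 reach_prob_le1 trans_ge0 : core.

Lemma reach_prob_fin A s : reach_prob A s \is a fin_num.
Proof. by rewrite ge0_fin_numE// (le_lt_trans (reach_prob_le1 _ _))// ltry. Qed.

Lemma reach_prob1 A s : A s -> reach_prob A s = 1.
Proof.
move=> As; rewrite /reach_prob run_measure_step; last exact: measurable_finally.
rewrite -(trans_sum1 s); apply: eq_esum => t _.
rewrite (_ : _ @^-1` _ = setT) ?probability_setT ?mule1//.
by apply/seteqP; split => // pi _; exists 0%N.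
Qed.

Lemma reach_prob_step A s : ~ A s ->
  reach_prob A s = \esum_(t in [set: M]) ((trans s t)%:E * reach_prob A t).
Proof.
move=> As; rewrite /reach_prob run_measure_step; last exact: measurable_finally.
apply: eq_esum => t _; congr (_ * _); congr (run_measure t _).
apply/seteqP; split => pi /=; first by move=> [[|i] Ai] //; exists i.
by move=> [i Ai]; exists i.+1.
Qed.

Lemma reach_prob_super A s :
  \esum_(t in [set: M]) ((trans s t)%:E * reach_prob A t) <= reach_prob A s.
Proof.
have [As|As] := pselect (A s); last by rewrite -reach_prob_step.
rewrite reach_prob1// -(trans_sum1 s); apply: le_esum => t _.
by rewrite -[leRHS]mule1 lee_wpmul2l// lee_fin.
Qed.

(** Reachability is the least supersolution of the one-step equations: by induction on [n], [f]
    bounds the probability of meeting [A] among the first [n] positions, and these probabilities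
    increase to the limit. The left alternative admits states where the bound is known directly,
    such as those in [A]. *)
Lemma reach_prob_min A (f : M -> \bar R) :
  (forall s, 0 <= f s) ->
  (forall s, reach_prob A s <= f s \/
    ~ A s /\ \esum_(t in [set: M]) ((trans s t)%:E * f t) <= f s) ->
  forall s, reach_prob A s <= f s.
Proof.
move=> f0 fS s.
pose E n : set (run M) := [set pi | exists2 i, (i < n)%N & A (pi i)].
have mE n : @measurable _ runT (E n).
  rewrite (_ : E n = \bigcup_(i in `I_n) [set pi | A (pi i)]).
    by apply: bigcup_measurable => i _; exact: measurable_run_coord.
  by apply/seteqP; split => pi /= [i ni]; exists i.
have leE n : forall t, run_measure t (E n) <= f t.
  elim: n => [|n ih] t.
    rewrite (_ : E 0%N = set0) ?measure0//.
    by apply/seteqP; split => // pi [].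
  have [|[At]] := fS t; apply: le_trans.
    apply: le_measure; rewrite ?inE//; first exact: measurable_finally.
    by move=> pi [i _ Ai]; exists i.
  rewrite run_measure_step//.
  apply: le_esum => u _; rewrite lee_wpmul2l ?lee_fin//.
  rewrite (_ : _ @^-1` _ = E n)//.
  apply/seteqP; split => pi /=; first by move=> [[|i] ni Ai] //; exists i.
  by move=> [i ni Ai]; exists i.+1.
have UE : \bigcup_n E n = [set pi | exists i, A (pi i)].
  apply/seteqP; split => pi /=; first by move=> [n _ [i _ Ai]]; exists i.
  by move=> [i Ai]; exists i.+1 => //; exists i.
have : run_measure s (E n) @[n --> \oo] --> run_measure s (\bigcup_n E n).
  apply: nondecreasing_cvg_mu => //; first exact: bigcupT_measurable.
  move=> m n mn; apply/subsetPset => pi [i im Ai]; exists i => //.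
  exact: leq_trans im mn.
rewrite UE -/(reach_prob A s) => cE; rewrite -(cvg_lim _ cE)//.
apply: lime_le; first by apply/cvg_ex; exists (reach_prob A s).
by apply: nearW => n; exact: leE.
Qed.

(** Positivity propagates backwards along a path. Conversely, the indicator of the states that can
    reach [A] is a supersolution, so minimality forces probability zero elsewhere. *)
Lemma reach_prob_gt0 A s : 0 < reach_prob A s <-> exists2 v, reach s v & A v.
Proof.
split=> [|[v [p]]]; last first.
  elim: p s => /= [|t p ih] s; first by move=> _ <- /reach_prob1 ->.
  move=> /andP[st pt] lv Av; apply: lt_le_trans (reach_prob_super A s).
  apply: lt_le_trans (esum_term_le t _); last first.
    by move=> u; rewrite mule_ge0// lee_fin.
  by rewrite mule_gt0// ?lte_fin//; exact: ih.
apply: contraPP => nA; apply/negP; rewrite -leNgt.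
pose f u : \bar R := (`[< exists2 v, reach u v & A v >]%:R)%:E.
have f1 u : f u <= 1 by rewrite /f; case: asboolP.
have /(_ s) : forall u, reach_prob A u <= f u.
  apply: reach_prob_min => u.
  - by rewrite /f lee_fin.
  - rewrite {1 3}/f; case: asboolP => [_|nu]; first by left.
    right; split; first by move=> Au; apply: nu; exists u => //; exact: reach_refl.
    rewrite esum1// => t _; rewrite /f; case: asboolP => [[v tv Av]|_]; last first.
      by rewrite mule0.
    have [ut|ut] := ltP 0%R (trans u t).
      by exfalso; apply: nu; exists v => //; exact: reach_trans (edge_reach ut) tv.
    have /eqP -> : trans u t == 0%R by rewrite eq_le ut trans_ge0.
    by rewrite mul0e.
by rewrite /f asboolF.
Qed.

Lemma globallyE A s :
  run_measure s [set pi | forall i, A (pi i)] = 1 - reach_prob (~` A) s.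
Proof.
rewrite /reach_prob -probability_setC; last exact: measurable_finally.
congr (run_measure s _); apply/seteqP; split => pi /=.
  by move=> h [i]; apply; exact: h.
by move=> h i; apply: contrapT => nA; apply: h; exists i.
Qed.

(** The probability-one operator becomes a property of the transition graph, because a single
    reachable violation already has positive probability. *)
Lemma sat_globally1 (q : bound) (psi : formula AP) s : val q = 1%R ->
  sat (Globally Ge q psi) s <-> forall v, reach s v -> sat psi v.
Proof.
move=> q1; rewrite /= q1 rmorph1 globallyE -(fineK (reach_prob_fin _ _)).
rewrite -EFinB lee_fin lerBrDr gerDl -lee_fin fineK ?reach_prob_fin//.
split=> [le0 v sv|h].
  apply: contrapT => nv; move: le0; apply/negP; rewrite -ltNge.
  by apply/reach_prob_gt0; exists v.
by rewrite leNgt; apply/negP => /reach_prob_gt0[v /h].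
Qed.

(** Membership [B u] is part of the event, which is thus empty for [u] outside [B]; sums of hitting
    probabilities can then range over all states. *)
Definition first_hit_event B u : set (run M) :=
  [set pi | exists i, [/\ pi i = u, B u & forall j, (j < i)%N -> ~ B (pi j)]].

Definition first_hit B s u : R := fine (run_measure s (first_hit_event B u)).

Lemma measurable_first_hit_event B u :
  @measurable _ runT (first_hit_event B u).
Proof.
have [Bu|nBu] := pselect (B u); last first.
  rewrite (_ : first_hit_event B u = set0)//.
  by apply/seteqP; split => // pi [i []].
rewrite (_ : first_hit_event B u = \bigcup_i ([set pi | [set u] (pi i)] `&`
    \bigcap_(j in `I_i) [set pi | (~` B) (pi j)])); last first.
  apply/seteqP; split => pi /=.
    by move=> [i [ui _ ni]]; exists i => //; split => // j; exact: ni.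
  by move=> [i _ [ui ni]]; exists i; split => // j; exact: ni.
apply: bigcupT_measurable => i; apply: measurableI.
  exact: (@measurable_run_coord _ _ M [set u]).
by apply: bigcap_measurableType => j _; exact: (@measurable_run_coord _ _ M (~` B)).
Qed.

Lemma first_hitE B s u :
  (first_hit B s u)%:E = run_measure s (first_hit_event B u).
Proof.
rewrite /first_hit fineK// ge0_fin_numE//; apply: le_lt_trans (ltry 1%R).
by apply: probability_le1; exact: measurable_first_hit_event.
Qed.

Lemma first_hit_ge0 B s u : (0 <= first_hit B s u)%R.
Proof. by rewrite -lee_fin first_hitE. Qed.

Hint Resolve first_hit_ge0 : core.

Lemma first_hit_start B s u : B s -> first_hit B s u = (u == s)%:R.
Proof.
move=> Bs; apply: EFin_inj; rewrite first_hitE.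
rewrite run_measure_step; last exact: measurable_first_hit_event.
have [->|us] := eqVneq u s.
  rewrite -(trans_sum1 s); apply: eq_esum => t _.
  rewrite (_ : _ @^-1` _ = setT) ?probability_setT ?mule1//.
  by apply/seteqP; split => // pi _; exists 0%N.
apply: esum1 => t _; rewrite (_ : _ @^-1` _ = set0) ?measure0 ?mule0//.
apply/seteqP; split => // pi [[|i] []] /=; first by move=> /esym/eqP; rewrite (negPf us).
by move=> _ _ /(_ 0%N erefl).
Qed.

Lemma first_hit_step B s u : ~ B s ->
  (first_hit B s u)%:E =
  \esum_(t in [set: M]) ((trans s t)%:E * (first_hit B t u)%:E).
Proof.
move=> Bs; rewrite first_hitE run_measure_step; last first.
  exact: measurable_first_hit_event.
apply: eq_esum => t _; rewrite first_hitE; congr (_ * run_measure t _).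
apply/seteqP; split => pi.
  move=> [[|i] /= []]; first by move=> <-.
  by move=> pu Bu h; exists i; split => // j ji; exact: (h j.+1).
move=> [i [pu Bu h]]; exists i.+1; split => //=.
by case=> //= j ji; exact: h.
Qed.

(** The events for distinct [u] are disjoint; the deficit from 1 is the probability of never hitting
    [B]. *)
Lemma first_hit_sum B s :
  \esum_(u in [set: M]) (first_hit B s u)%:E <= 1.
Proof.
under eq_esum => u _ do rewrite first_hitE.
apply: ge_ereal_sup => _ [X [finX _] <-].
rewrite -measure_fin_bigcup//.
- apply: probability_le1; apply: fin_bigcup_measurable => // u _.
  exact: measurable_first_hit_event.
- apply/trivIsetP => u v _ _ uv; apply/seteqP; split => // pi.
  move=> [[i [iu Bu hi]] [j [jv Bv hj]]].
  have [ij|ji|ij] := ltngtP i j.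
  + by apply: (hj i ij); rewrite iu.
  + by apply: (hi j ji); rewrite jv.
  + by move: uv; rewrite -iu -jv ij eqxx.
- by move=> u _; exact: measurable_first_hit_event.
Qed.

Lemma first_hit_gt0 B s u : (0 < first_hit B s u)%R -> B u /\ reach s u.
Proof.
rewrite -lte_fin first_hitE => hit; split.
  apply: contrapT => Bu; move: hit.
  rewrite (_ : first_hit_event B u = set0) ?measure0 ?ltxx//.
  by apply/seteqP; split => // pi [i []].
suff /reach_prob_gt0[v sv <-] : 0 < reach_prob [set u] s by [].
apply: lt_le_trans hit _; apply: le_measure; rewrite ?inE.
- exact: measurable_first_hit_event.
- exact: measurable_finally.
- by move=> pi [i [iu _ _]]; exists i.
Qed.

(** As a function of [s], the right-hand side equals [reach_prob A] on [B] and solves the one-step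
    equations off [B], so minimality applies. *)
Lemma reach_prob_first_hit A B s : A `<=` B ->
  reach_prob A s <=
  \esum_(u in [set: M]) ((first_hit B s u)%:E * reach_prob A u).
Proof.
move=> AB.
pose f s := \esum_(u in [set: M]) ((first_hit B s u)%:E * reach_prob A u).
have hr0 v u : 0 <= (first_hit B v u)%:E * reach_prob A u.
  by rewrite mule_ge0// lee_fin.
apply: (@reach_prob_min A f) => {}s; first exact: esum_ge0.
have [Bs|Bs] := pselect (B s); [left|right].
  rewrite /f (esum_single (t := s))//.
    by rewrite first_hit_start// eqxx mul1e.
  by move=> u /negPf us; rewrite first_hit_start// us mul0e.
split; first by move=> /AB.
rewrite {2}/f; under [leRHS]eq_esum => u _.
  rewrite first_hit_step// muleC -(fineK (reach_prob_fin A u)) -esumZl; last 2 first.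
  - by rewrite -lee_fin fineK// reach_prob_fin.
  - by move=> t; rewrite mule_ge0// lee_fin.
  rewrite fineK ?reach_prob_fin//.
  over.
rewrite esum_exchange; last by move=> u t; rewrite !mule_ge0// lee_fin.
apply: le_esum => t _; rewrite /f -esumZl//.
by apply: le_esum => u _; rewrite [leRHS]muleC muleA.
Qed.

End reachability.

(** * Restriction to closed sets of states, and tree-shaped chains *)

Section restriction.
Local Open Scope ereal_scope.
Context {R : realType} {AP : finType} (M : markov_chain R AP) (K : pred M).
Context (K_init : K (init M)).
Context (K_closed : forall s t, K s -> (0 < trans s t)%R -> K t).

Let sub := {s : M | K s}.

Let esum_sub (s : sub) (f : M -> \bar R) : (forall t, 0 <= f t) ->
  \esum_(t in [set: M]) ((trans (sval s) t)%:E * f t) =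
  \esum_(t in [set: sub]) ((trans (sval s) (sval t))%:E * f (sval t)).
Proof.
move=> f0; rewrite (esum_range (g := @sval _ K))//.
- exact: val_inj.
- by move=> t; rewrite mule_ge0// lee_fin trans_ge0.
- move=> t nt; have [st|st] := ltP 0%R (trans (sval s) t).
    by case: nt; exists (exist _ t (K_closed (svalP s) st)).
  have /eqP -> : trans (sval s) t == 0%R by rewrite eq_le st trans_ge0.
  by rewrite mul0e.
Qed.

Let restrict_sum1 (s : sub) :
  \esum_(t in [set: sub]) (trans (sval s) (sval t))%:E = 1.
Proof.
rewrite -(trans_sum1 (sval s)).
have := esum_sub s (f := fun=> 1) (fun=> lee01).
by under eq_esum do rewrite mule1; under [RHS]eq_esum do rewrite mule1.
Qed.

Definition restrict : markov_chain R AP := @MarkovChain R AP sub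
  (fun s t => trans (sval s) (sval t)) (exist _ (init M) K_init)
  (fun s => label (sval s)) (fun s t => trans_itv (sval s) (sval t))
  restrict_sum1.

(** Each side yields a supersolution for the other chain; minimality is used once in each
    direction. *)
Lemma reach_prob_restrict (A : set M) (s : restrict) :
  reach_prob (fun t : restrict => A (sval t)) s = reach_prob A (sval s).
Proof.
apply/eqP; rewrite eq_le; apply/andP; split.
  apply: (@reach_prob_min _ _ restrict _ (fun t => reach_prob A (sval t))).
    by move=> t; exact: reach_prob_ge0.
  move=> t; have [At|At] := pselect (A (sval t)).
    by left; rewrite !reach_prob1.
  by right; split => //; rewrite [leRHS]reach_prob_step// esum_sub// => u;
    exact: reach_prob_ge0.
(* The default value 1 outside [K] dominates every reachability probability, so the left alternative
   of [reach_prob_min] holds there. *)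
pose f t : \bar R := if insub t is Some u
  then reach_prob (M := restrict) (fun t : restrict => A (sval t)) u else 1.
have fE (t : sub) :
    f (sval t) = reach_prob (M := restrict) (fun t : restrict => A (sval t)) t.
  by rewrite /f (valK t).
have f0 t : 0 <= f t by rewrite /f; case: insub => *; rewrite ?reach_prob_ge0.
rewrite -fE; apply: reach_prob_min => // t.
have [Kt|nKt] := boolP (K t); last first.
  by left; rewrite /f insubN// reach_prob_le1.
have [At|At] := pselect (A t); [left|right].
  by rewrite (fE (exist _ t Kt)) !reach_prob1.
split => //; rewrite (fE (exist _ t Kt)) reach_prob_step//.
rewrite (esum_sub (exist _ t Kt))//; apply: le_esum => u _.
by rewrite -fE.
Qed.

Lemma sat_restrict (psi : formula AP) :
  sat psi = (fun s : restrict => sat psi (sval s)).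
Proof.
apply/funext; elim: psi => //= [f ihf g ihg|f ihf g ihg|c q f ih|c q f ih] s.
- by rewrite ihf ihg.
- by rewrite ihf ihg.
- by move/funext: ih => ih; rewrite -!/(reach_prob _ _) ih reach_prob_restrict.
- move/funext: ih => ih; rewrite !globallyE ih.
  by rewrite -(reach_prob_restrict (~` sat f)).
Qed.

End restriction.

(** * Chains on finite sequences: tree moves and a jump back to an ancestor *)

Section tree_chain.
Local Open Scope ereal_scope.
Context {R : realType} {AP : finType} (I : countType).
Context (c : seq I -> I -> R) (up : seq I -> nat) (lab : seq I -> {set AP}).
Context (c_ge0 : forall x a, (0 <= c x a)%R).
Context (c_sum : forall x, \esum_(a in [set: I]) (c x a)%:E <= 1).
Implicit Types (x y : seq I) (a : I).

Definition stay x : R := (1 - fine (\esum_(a in [set: I]) (c x a)%:E))%R.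

Let c_sum_ge0 x : 0 <= \esum_(a in [set: I]) (c x a)%:E.
Proof. by apply: esum_ge0 => a _; rewrite lee_fin. Qed.

Let c_sum_fin x : \esum_(a in [set: I]) (c x a)%:E \is a fin_num.
Proof. by rewrite ge0_fin_numE// (le_lt_trans (c_sum x))// ltry. Qed.

Lemma stayE x : (stay x)%:E = 1 - \esum_(a in [set: I]) (c x a)%:E.
Proof. by rewrite /stay EFinB fineK. Qed.

Lemma stay_ge0 x : (0 <= stay x)%R.
Proof. by rewrite -lee_fin stayE sube_ge0 ?c_sum ?c_sum_fin. Qed.

(* A state is the sequence of moves leading to it from the root, newest first;
   the probability not spent on children goes to the [up x]-fold parent. *)
Definition tree_trans x y : R :=
  ((if y is a :: x' then (x' == x)%:R * c x a else 0) +
   (y == drop (up x) x)%:R * stay x)%R.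

Lemma tree_trans_ge0 x y : (0 <= tree_trans x y)%R.
Proof.
rewrite addr_ge0//; last by rewrite mulr_ge0// stay_ge0.
by case: y => // a y; rewrite mulr_ge0.
Qed.

Lemma tree_trans_esum x (f : seq I -> \bar R) : (forall y, 0 <= f y) ->
  \esum_(y in [set: seq I]) ((tree_trans x y)%:E * f y) =
  \esum_(a in [set: I]) ((c x a)%:E * f (a :: x)) +
  (stay x)%:E * f (drop (up x) x).
Proof.
move=> f0.
pose g y : R := if y is a :: x' then ((x' == x)%:R * c x a)%R else 0%R.
pose h y : R := ((y == drop (up x) x)%:R * stay x)%R.
have g0 y : (0 <= g y)%R by case: y => // a y; rewrite /g mulr_ge0.
have h0 y : (0 <= h y)%R by rewrite /h mulr_ge0// stay_ge0.
under eq_esum => y _ do rewrite /tree_trans -/(g y) -/(h y) EFinD ge0_muleDl ?lee_fin//.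
rewrite esumD//; try by move=> y _; rewrite mule_ge0// lee_fin.
congr (_ + _).
- rewrite (esum_range (g := cons^~ x)).
  + by apply: eq_esum => a _; rewrite /g eqxx mul1r.
  + by move=> a b [].
  + by move=> y; rewrite mule_ge0// lee_fin.
  + move=> [|a y] nr; rewrite /g ?mul0e//.
    have [yx|] := eqVneq y x; last by rewrite mul0r mul0e.
    by case: nr; exists a => //; rewrite yx.
- rewrite (esum_single (t := drop (up x) x)).
  + by rewrite /h eqxx mul1r.
  + by move=> y; rewrite mule_ge0// lee_fin.
  + by move=> y /negPf yx; rewrite /h yx mul0r mul0e.
Qed.

Lemma tree_trans_sum1 x :
  \esum_(y in [set: seq I]) (tree_trans x y)%:E = 1.
Proof.
have := tree_trans_esum x (f := fun=> 1) (fun=> lee01).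
under eq_esum do rewrite mule1; under [X in _ = X + _]eq_esum do rewrite mule1.
by rewrite mule1 stayE => ->; rewrite addeC subeK ?c_sum_fin.
Qed.

Lemma tree_trans_itv x y : (0 <= tree_trans x y <= 1)%R.
Proof.
rewrite tree_trans_ge0 -lee_fin -(tree_trans_sum1 x).
by apply: (esum_term_le y (a := fun y => (tree_trans x y)%:E)) => z;
  rewrite lee_fin tree_trans_ge0.
Qed.

Definition tree_chain : markov_chain R AP := @MarkovChain R AP (seq I)
  tree_trans [::] lab tree_trans_itv tree_trans_sum1.

Lemma tree_reach_prob_super (A : set tree_chain) x :
  \esum_(a in [set: I]) ((c x a)%:E * reach_prob A (a :: x : tree_chain)) +
  (stay x)%:E * reach_prob A (drop (up x) x : tree_chain) <=
  reach_prob A (x : tree_chain).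
Proof.
have := reach_prob_super A (x : tree_chain).
by rewrite (tree_trans_esum x (f := reach_prob A))// => y; exact: reach_prob_ge0.
Qed.

(** The nodes reached from the root by tree moves of positive probability. Only on these is the
    transition graph a tree with back edges. *)
Fixpoint valid x : bool :=
  if x is a :: x' then valid x' && (0 < c x' a)%R else true.

Lemma valid_drop n x : valid x -> valid (drop n x).
Proof. by elim: x n => //= a x ih [|n] //= /andP[/ih]. Qed.

Lemma tree_trans_gt0 x y : (0 < tree_trans x y)%R ->
  (exists2 a, y = a :: x & (0 < c x a)%R) \/ y = drop (up x) x.
Proof.
have [->|] := eqVneq y (drop (up x) x); first by right.
rewrite /tree_trans => /negPf ->; rewrite mul0r addr0; left.
case: y H => [|a y]; first by rewrite ltxx.
by have [->|] := eqVneq y x; rewrite ?mul1r ?mul0r ?ltxx//; exists a.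
Qed.

Lemma valid_closed (x y : tree_chain) :
  valid x -> (0 < trans x y)%R -> valid y.
Proof.
move=> vx /tree_trans_gt0[[a -> ca]|->]; last exact: valid_drop.
by rewrite /= vx.
Qed.

Definition valid_chain : markov_chain R AP :=
  @restrict R AP tree_chain valid isT valid_closed.

(** Positivity of the move is contained in the validity of [t]. *)
Let child : rel valid_chain :=
  fun s t => if sval t is _ :: y then y == sval s else false.

Let root : valid_chain := init valid_chain.

Let path_size (p : seq valid_chain) (x : valid_chain) : path child x p ->
  size (sval (last x p)) = (size (sval x) + size p)%N.
Proof.
elim: p x => /= [|y p ih] x; first by rewrite addn0.
move=> /andP[xy /ih ->]; rewrite addnS -addSn; congr (_ + _)%N.
by move: xy; rewrite /child; case: (sval y) => //= a y' /eqP ->.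
Qed.

Let path_to (x : seq I) (vx : valid x) :
  exists p, path child root p /\ last root p = exist _ x vx.
Proof.
elim: x vx => [|a x ih] vx; first by exists [::]; split => //; exact: val_inj.
have /andP[vx' ca] := vx.
have [p [pp lp]] := ih vx'; exists (rcons p (exist _ (a :: x) vx)).
by rewrite last_rcons rcons_path pp lp; split => //; rewrite /child /=.
Qed.

(** The parent of a node is its tail, so a path is determined backwards from its end. *)
Let path_inj (p p' : seq valid_chain) : path child root p ->
  path child root p' -> last root p = last root p' -> p = p'.
Proof.
elim/last_ind: p p' => [|p x ih] p'.
  move=> _ pp' lp; have := path_size pp'; rewrite -lp /= add0n.
  by move/esym/size0nil.
case/lastP: p' => [|p' x'].
  by move=> pp _ lp; have := path_size pp; rewrite lp /= size_rcons.
rewrite !rcons_path !last_rcons => /andP[pp lx] /andP[pp' lx'] xx'.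
rewrite -xx' in lx' *; congr rcons; apply: ih => //; apply: val_inj => /=.
by move: lx lx'; rewrite /child; case: (sval x) => // a y /eqP <- /eqP <-.
Qed.

Lemma valid_chain_height n : (forall x, valid x -> (size x <= n)%N) ->
  exists2 h, (h <= n)%N & has_height valid_chain h.
Proof.
move=> vn.
(* [has_height] asks for the exact height: it is the largest length of a valid sequence, which may
   lie below [n]. *)
pose P k := `[< exists2 x, valid x & size x = k >].
have P0 : exists k, P k by exists 0%N; apply/asboolP; exists [::].
have Pn k : P k -> (k <= n)%N by move=> /asboolP[x /vn + <-].
case: (ex_maxnP P0 Pn) => h /asboolP[x vx xh] hmax.
exists h; first by rewrite -xh; exact: vn.
exists child; split.
- move=> [y vy]; have [p [pp lp]] := path_to vy.
  exists p; split=> [//|p' [pp' lp']].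
  by apply: path_inj => //; rewrite lp.
- split=> [|p pp].
    have [p [pp lp]] := path_to vx; exists p => //.
    by have := path_size pp; rewrite lp /= xh add0n.
  have := path_size pp; rewrite add0n => <-.
  by apply: hmax; apply/asboolP; case: (last root p) => y vy; exists y.
- move=> [y vy] [z vz]; rewrite /child /=.
  case: z vz => // a z /= /andP[vz ca] /eqP zy.
  rewrite /tree_trans -zy eqxx mul1r ltr_wpDr// mulr_ge0// stay_ge0//.
- move=> [y vy] [z vz] /= /tree_trans_gt0 [[a zE ca]|zE].
    by left; rewrite /child /= zE eqxx.
  (* The jump length is generalized before the induction on [y], since it would otherwise change
     with [y]. *)
  right; subst z; move: (up y) vz => k.
  elim: y k vy => [|b y ih] [|k] vy vz.
  + by exists [::] => //; exact: val_inj.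
  + by exists [::] => //; exact: val_inj.
  + by exists [::] => //; exact: val_inj.
  + have vy' : valid y by case/andP: vy.
    have [p pp lp] := ih k vy' vz.
    exists (rcons p (exist _ (b :: y) vy)); last by rewrite last_rcons.
    by rewrite rcons_path pp lp /child /=.
Qed.

End tree_chain.

(** * Goals and terminal states *)

HB.instance Definition _ (AP : finType) := gen_eqMixin (formula AP).

Section formulas.
Context {AP : finType}.
Implicit Types (f g psi : formula AP) (B : seq (formula AP)).

(** Bodies under [Globally] are left out: they are treated as invariants, not as goals. *)
Fixpoint local_goals psi : seq (formula AP) :=
  match psi with
  | And f g => local_goals f ++ local_goals g
  | Finally _ _ f => [:: f]
  | _ => [::]
  end.

(** Conjunction adds the depths because the goals of the two conjuncts may be fulfilled one after
    the other. *)
Fixpoint local_depth psi : nat :=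
  match psi with
  | And f g => local_depth f + local_depth g
  | Finally _ _ f => (local_depth f).+1
  | _ => 0
  end.

Fixpoint hasG psi : bool :=
  match psi with
  | And f g | Or f g => hasG f || hasG g
  | Finally _ _ f => hasG f
  | Globally _ _ _ => true
  | _ => false
  end.

Lemma formula_length_gt0 psi : (0 < formula_length psi)%N.
Proof. by case: psi. Qed.

(** The extra units pay for the move to the centre of a star and, if there is a [Globally], for the
    move on to a leaf. *)
Lemma local_depth_length psi :
  ((local_depth psi).+1 + hasG psi <= formula_length psi)%N.
Proof.
elim: psi => //= [f ihf g ihg|f _ g _|_ _ f _].
- rewrite addSn ltnS; apply: leq_trans (leq_add ihf ihg).
  rewrite addnACA leq_add ?leq_add//.
  by case: (hasG f); case: (hasG g).
- rewrite addnC addn1 ltnS; case: (_ || _) => //.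
  by rewrite addn_gt0 formula_length_gt0.
- by rewrite addn1 ltnS formula_length_gt0.
Qed.

Definition goals_depth B : nat := sumn [seq (local_depth f).+1 | f <- B].

Lemma goals_depth_cat B B' :
  goals_depth (B ++ B') = (goals_depth B + goals_depth B')%N.
Proof. by rewrite /goals_depth map_cat sumn_cat. Qed.

Lemma goals_depth_local psi : goals_depth (local_goals psi) = local_depth psi.
Proof.
elim: psi => //= [f ihf g ihg|_ _ f _]; first by rewrite goals_depth_cat ihf ihg.
by rewrite /goals_depth /= addn0.
Qed.

Lemma compare_mono (R : realType) c q (p p' : \bar R) :
  compare c q p -> (p <= p')%E -> compare c q p'.
Proof. by case: c => /=; [exact: le_trans|exact: lt_le_trans]. Qed.

(** Together with [reach_prob_gt0], this extracts a reachable witness from a nontrivial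
    [Finally]. *)
Lemma compare_gt0 (R : realType) c q (p : \bar R) : ~ compare (R := R) c q 0%E ->
  (0 <= p)%E -> compare c q p -> (0 < p)%E.
Proof.
move=> n0 p0 cp; rewrite lt_neqAle p0 andbT; apply/eqP => p0'.
by rewrite -p0' in cp.
Qed.

End formulas.

(** * Invariants, terminal states and the update of goals *)

Section terminal_states.
Context {R : realType} {AP : finType} {M : markov_chain R AP}.
Implicit Types (f g psi : formula AP) (s t u v : M).

Definition invariant psi s := forall v, reach s v -> sat psi v.

Lemma invariant_reach psi s t : reach s t -> invariant psi s -> invariant psi t.
Proof. by move=> st h v tv; apply: h; exact: reach_trans st tv. Qed.

Fixpoint terminal psi t : Prop :=
  match psi with
  | And f g | Or f g => terminal f t /\ terminal g t
  | Finally _ _ f => terminal f t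
  | Globally _ _ f =>
      terminal f t /\ forall v, reach t v -> invariant f v -> invariant f t
  | _ => True
  end.

Lemma terminal_reach psi t v : reach t v -> terminal psi t -> terminal psi v.
Proof.
move=> tv; elim: psi => //= [f ihf g ihg|f ihf g ihg|_ _ f ih].
- by move=> [/ihf ? /ihg].
- by move=> [/ihf ? /ihg].
- move=> [/ih ? h]; split => // u vu fu.
  exact: invariant_reach tv (h u (reach_trans tv vu) fu).
Qed.

(** The subformulas are treated in turn: for each [Globally], move to a reachable state where its
    body is invariant if there is one. Later moves preserve what was achieved, by
    [terminal_reach]. *)
Lemma terminal_exists psi s : exists2 t, reach s t & terminal psi t.
Proof.
elim: psi s => [a|a|f ihf g ihg|f ihf g ihg|_ _ f ih|_ _ f ih] s /=.
- by exists s => //; exact: reach_refl.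
- by exists s => //; exact: reach_refl.
- have [t st ft] := ihf s; have [u tu gu] := ihg t.
  by exists u; [exact: reach_trans st tu|split => //; exact: terminal_reach ft].
- have [t st ft] := ihf s; have [u tu gu] := ihg t.
  by exists u; [exact: reach_trans st tu|split => //; exact: terminal_reach ft].
- exact: ih.
- have [t st ft] := ih s.
  have [[v tv fv]|nv] := pselect (exists2 v, reach t v & invariant f v).
    exists v; first exact: reach_trans st tv.
    by split => //; exact: terminal_reach ft.
  by exists t => //; split => // v tv fv; case: nv; exists v.
Qed.

Definition next_goals (B : seq (formula AP)) u : seq (formula AP) :=
  flatten [seq if `[< sat f u >] then local_goals f else [:: f] | f <- B].

Lemma next_goals_le B u : (goals_depth (next_goals B u) <= goals_depth B)%N.
Proof.
elim: B => //= f B ih; rewrite [next_goals _ _]/= goals_depth_cat leq_add//.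
case: asboolP => _; first by rewrite goals_depth_local.
by rewrite /goals_depth /= addn0.
Qed.

(** A fulfilled body of weight [(local_depth f).+1] leaves behind goals of total weight
    [local_depth f]. *)
Lemma next_goals_lt B f u : f \in B -> sat f u ->
  (goals_depth (next_goals B u) < goals_depth B)%N.
Proof.
elim: B => //= g B ih; rewrite [next_goals _ _]/= goals_depth_cat inE.
case/predU1P => [<- fu|/ih{}ih /ih{}ih].
  by rewrite asboolT// goals_depth_local -addSn leq_add// next_goals_le.
rewrite -addnS leq_add//.
case: asboolP => _; first by rewrite goals_depth_local.
by rewrite /goals_depth /= addn0.
Qed.

Lemma next_goals_sat B f u : f \in B -> sat f u ->
  {subset local_goals f <= next_goals B u}.
Proof.
move=> fB fu g gf; apply/flattenP; exists (local_goals f) => //.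
by apply/mapP; exists f => //; rewrite asboolT.
Qed.

Lemma next_goals_nsat B f u : f \in B -> ~ sat f u -> f \in next_goals B u.
Proof.
move=> fB fu; apply/flattenP; exists [:: f]; last by rewrite mem_head.
by apply/mapP; exists f => //; rewrite asboolF.
Qed.

End terminal_states.

(** * The tree of stars *)

Section construction.
Local Open Scope ereal_scope.
Context {R : realType} {AP : finType} (M : markov_chain R AP) (phi : formula AP).
Context (term : M -> M) (w : M -> R).
Context (reach_term : forall s, reach s (term s)).
Context (terminal_term : forall s, terminal phi (term s)).
Context (w_gt0 : forall s, (0 < w s)%R).
Context (w_sum : \esum_(s in [set: M]) (w s)%:E <= 1).
Implicit Types (s t u v : M) (f g psi : formula AP).

(* [inl u] enters a copy of [u] that still has goals to fulfil, [inr (inl t)]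
   the centre of a star, and [inr (inr v)] one of the leaves of that star. *)
Definition move : countType := (M + (M + M))%type.
Implicit Types (x y z : seq move) (a : move).

Definition at_state x : M :=
  if x is a :: _ then
    match a with inl u | inr (inl u) | inr (inr u) => u end
  else init M.

Fixpoint goals x : seq (formula AP) :=
  if x is a :: x' then next_goals (goals x') (at_state x)
  else local_goals phi.

Definition goal_set x : set M := [set u | exists2 f, f \in goals x & sat f u].

Definition is_tree x : bool := if x is inr _ :: _ then false else true.

(** A tree node spends all its mass on children: first hits of goals, and the probability of hitting
    none on one centre. A centre keeps what its leaves do not use; if [phi] has no [Globally], it
    has no leaves and is absorbing. *)
Definition branch x a : R :=
  match x, a with
  | inr (inl t) :: _, inr (inr v) =>
      if hasG phi && `[< reach t v >] then w v else 0%R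
  | inr _ :: _, _ => 0%R
  | _, inl u => first_hit (goal_set x) (at_state x) u
  | _, inr (inl t) => ((t == term (at_state x))%:R * (1 - fine
      (\esum_(u in [set: M]) (first_hit (goal_set x) (at_state x) u)%:E)))%R
  | _, inr (inr _) => 0%R
  end.

(** A leaf returns to its centre; at a centre the value 0 gives a self-loop, and tree nodes have no
    mass left to send back. *)
Definition up x : nat := if x is inr (inr _) :: _ then 1 else 0.

Let rest x : R := (1 - fine
  (\esum_(u in [set: M]) (first_hit (goal_set x) (at_state x) u)%:E))%R.

Let branch_tree x a : is_tree x -> branch x a =
  match a with
  | inl u => first_hit (goal_set x) (at_state x) u
  | inr (inl t) => ((t == term (at_state x))%:R * rest x)%R
  | inr (inr _) => 0%R
  end.
Proof. by case: x => [|[u|//] x] _ /=. Qed.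

Let hit_fin x :
  \esum_(u in [set: M]) (first_hit (goal_set x) (at_state x) u)%:E \is a fin_num.
Proof.
rewrite ge0_fin_numE; last by apply: esum_ge0 => u _; rewrite lee_fin first_hit_ge0.
by rewrite (le_lt_trans (first_hit_sum _ _))// ltry.
Qed.

Let rest_ge0 x : (0 <= rest x)%R.
Proof. by rewrite subr_ge0 -lee_fin fineK// first_hit_sum. Qed.

Lemma branch_ge0 x a : (0 <= branch x a)%R.
Proof.
have [tx|] := boolP (is_tree x).
  rewrite branch_tree//; case: a => [u|[t|v]] //; first exact: first_hit_ge0.
  by rewrite mulr_ge0.
case: x => [//|[//|[t|v]] x] _ /=; case: a => [u|[s|u]] //.
by case: ifP => // _; rewrite ltW.
Qed.

Lemma branch_tree_esum x (h : move -> \bar R) : is_tree x ->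
  (forall a, 0 <= h a) ->
  \esum_(a in [set: move]) ((branch x a)%:E * h a) =
  \esum_(u in [set: M]) ((first_hit (goal_set x) (at_state x) u)%:E * h (inl u))
  + (rest x)%:E * h (inr (inl (term (at_state x)))).
Proof.
move=> tx h0; have bh0 a : 0 <= (branch x a)%:E * h a.
  by rewrite mule_ge0// lee_fin branch_ge0.
rewrite (@esum_sumtype _ M (M + M)%type)//; congr (_ + _).
  by apply: eq_esum => u _; rewrite branch_tree.
rewrite (@esum_sumtype _ M M)// [X in _ + X]esum1 ?adde0; last first.
  by move=> v _; rewrite branch_tree// mul0e.
rewrite (esum_single (t := term (at_state x)))//.
  by rewrite branch_tree// eqxx mul1r.
by move=> t /negPf tt; rewrite branch_tree// tt mul0r mul0e.
Qed.

Lemma branch_tree_sum x : is_tree x ->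
  \esum_(a in [set: move]) (branch x a)%:E = 1.
Proof.
move=> tx; have := branch_tree_esum tx (h := fun=> 1) (fun=> lee01).
under eq_esum do rewrite mule1; under [X in _ = X + _]eq_esum do rewrite mule1.
by move=> ->; rewrite mule1 EFinB fineK// addeC subeK.
Qed.

Lemma branch_sum x : \esum_(a in [set: move]) (branch x a)%:E <= 1.
Proof.
have [tx|] := boolP (is_tree x); first by rewrite branch_tree_sum.
case: x => [//|[//|[t|v]] x] _; last first.
  by rewrite esum1//= => -[u|[u|u]].
rewrite (@esum_sumtype _ M (M + M)%type); last first.
  by move=> a; rewrite lee_fin branch_ge0.
rewrite esum1// add0e (@esum_sumtype _ M M); last first.
  by move=> a; rewrite lee_fin branch_ge0.
rewrite esum1// add0e; apply: le_trans w_sum; apply: le_esum => v _ /=.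
by rewrite lee_fin; case: ifP => // _; rewrite ltW.
Qed.

Definition star_tree : markov_chain R AP :=
  tree_chain up (fun x => label (at_state x)) branch_ge0 branch_sum.

Local Notation N := star_tree.
Local Notation ok x := (valid branch x).

Lemma valid_reach x a : ok (a :: x) -> reach (at_state x) (at_state (a :: x)).
Proof.
move=> /= /andP[_]; have [tx|] := boolP (is_tree x).
  rewrite branch_tree//; case: a => [u|[t|v]]; last by rewrite ltxx.
    by move=> /first_hit_gt0[].
  by have [->|] := eqVneq; [move=> _; exact: reach_term|rewrite mul0r ltxx].
case: x => [//|[//|[t|v]] x] _; case: a => [u|[s|u]] /=; rewrite ?ltxx//.
by case: ifP => [/andP[_ /asboolP]|]; rewrite ?ltxx.
Qed.

Lemma valid_leaf v x : ok (inr (inr v) :: x) -> exists t x',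
  [/\ x = inr (inl t) :: x', hasG phi & reach t v].
Proof.
move=> /andP[_]; case: x => [|[u|[t|u]] x] /=; rewrite ?ltxx//.
by case: ifP => [/andP[G /asboolP tv] _|]; rewrite ?ltxx//; exists t, x.
Qed.

Lemma valid_center t x : ok (inr (inl t) :: x) ->
  is_tree x /\ t = term (at_state x).
Proof.
move=> /andP[_]; have [tx|] := boolP (is_tree x).
  by rewrite branch_tree//; have [->|] := eqVneq; rewrite ?mul0r ?ltxx.
by case: x => [//|[//|[s|v]] x] _ /=; rewrite ltxx.
Qed.

Lemma valid_tree u x : ok (inl u :: x) ->
  [/\ is_tree x, (0 < first_hit (goal_set x) (at_state x) u)%R &
      (goals_depth (goals (inl u :: x)) < goals_depth (goals x))%N].
Proof.
move=> /andP[_]; have [tx|] := boolP (is_tree x); last first.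
  by case: x => [//|[//|[s|v]] x] _ /=; rewrite ltxx.
rewrite branch_tree// => hit; split => //.
have [[f fB fu] _] := first_hit_gt0 hit.
exact: next_goals_lt fB fu.
Qed.

(** A bound on the number of moves that can still extend [x]: fulfilments of goals, then a centre,
    then possibly a leaf. *)
Definition rank x : nat :=
  match x with
  | inr (inl _) :: _ => hasG phi
  | inr (inr _) :: _ => 0
  | _ => ((goals_depth (goals x)).+1 + hasG phi)%N
  end.

Lemma valid_rank x : ok x -> (size x + rank x <= rank [::])%N.
Proof.
elim: x => //= a x ih okx; have /andP[/ih{}ih _] := okx.
apply: leq_trans ih; rewrite addSnnS leq_add2l.
case: a okx => [u|[t|v]] okx.
- have [tx _ lt] := valid_tree okx.
  have -> : rank x = ((goals_depth (goals x)).+1 + hasG phi)%N.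
    by case: x tx {okx lt} => [|[|]].
  by rewrite /rank -addSn leq_add2r ltnS.
- have [tx _] := valid_center okx.
  have -> : rank x = ((goals_depth (goals x)).+1 + hasG phi)%N.
    by case: x tx {okx} => [|[|]].
  by rewrite /rank addSn ltnS leq_addl.
- by have [t [x' [-> G _]]] := valid_leaf okx; rewrite /rank G.
Qed.

Lemma valid_size x : ok x -> (size x <= formula_length phi)%N.
Proof.
move=> /valid_rank; rewrite /= goals_depth_local => h.
apply: leq_trans (local_depth_length phi); apply: leq_trans h.
exact: leq_addr.
Qed.

Lemma reach_prob_branch (A : set N) x :
  \esum_(a in [set: move]) ((branch x a)%:E * reach_prob A (a :: x : N)) <=
  reach_prob A (x : N).
Proof.
apply: le_trans (tree_reach_prob_super A x).
by rewrite leeDl// mule_ge0// ?reach_prob_ge0// lee_fin (stay_ge0 branch_ge0 branch_sum).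
Qed.

Lemma reach_prob_leaf (A : set N) v x :
  reach_prob A (x : N) <= reach_prob A (inr (inr v) :: x : N).
Proof.
apply: le_trans (tree_reach_prob_super A (inr (inr v) :: x)).
have b0 a : branch (inr (inr v) :: x) a = 0%R by case: a => [|[|]].
rewrite esum1; last by move=> a _; rewrite b0 mul0e.
rewrite add0e /= drop0 (stayE branch_ge0 branch_sum).
rewrite esum1 ?sube0 ?mul1e// => a _; by rewrite b0.
Qed.

(** What the inductions use about a subformula of [phi], in a form that passes down through the
    connectives. *)
Definition admissible psi := [/\ FqG1 psi,
  forall t, terminal phi t -> terminal psi t & hasG psi -> hasG phi].

Lemma admissible_And f g :
  admissible (And f g) -> admissible f /\ admissible g.
Proof.
move=> [[Ff Fg] T G]; split; split=> //.
- by move=> t /T[].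
- by move=> Gf; apply: G; rewrite /= Gf.
- by move=> t /T[].
- by move=> Gg; apply: G; rewrite /= Gg orbT.
Qed.

Lemma admissible_Globally q f : hasG phi ->
  admissible (Globally Ge q f) -> admissible f.
Proof. by move=> G [[_ Ff] T _]; split=> // t /T[]. Qed.

(** * Truth inside a single star *)

Section star.
Context (t : M) (x : seq move).
Context (G_phi : hasG phi).
Let center : seq move := inr (inl t) :: x.

Definition in_star (z : N) : Prop :=
  z = center \/ exists2 v, reach t v & z = inr (inr v) :: center.

Lemma in_star_reach z : in_star z -> reach t (at_state z).
Proof. by case=> [->|[v tv ->]] //=; exact: reach_refl. Qed.

Lemma in_star_closed (y z : N) : in_star y -> (0 < trans y z)%R -> in_star z.
Proof.
move=> sy /tree_trans_gt0[[a -> ca]|->]; last first.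
  by case: sy => [->|[v tv ->]]; left; rewrite /= ?drop0.
case: sy ca => [->|[v tv ->]]; case: a => [u|[s|u]] /=; rewrite ?ltxx//.
case: ifP => [/andP[_ /asboolP tu] _|]; rewrite ?ltxx//.
by right; exists u.
Qed.

(* The chain returns to the centre from every leaf, so its probability [p] of
   reaching [A] satisfies [p >= w v + (1 - w v) * p]. *)
Lemma star_reach_prob1 (A : set N) v z : reach t v ->
  A (inr (inr v) :: center) -> in_star z -> 1 <= reach_prob A z.
Proof.
move=> tv Av sz.
suff c1 : 1 <= reach_prob A (center : N).
  case: sz => [->//|[u _ ->]]; apply: le_trans c1 _; exact: reach_prob_leaf.
set p := reach_prob A (center : N).
have pfin : p \is a fin_num := reach_prob_fin _ _.
have sup := tree_reach_prob_super A center.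
pose a0 : move := inr (inr v).
have ba0 : branch center a0 = w v by rewrite /= G_phi asboolT.
(* Every leaf falls back to the centre and so has value at least [p]; the leaf [v] has value 1, a
   surplus of [w v * (1 - p)]. *)
have le1 : \esum_(a in [set: move]) ((branch center a)%:E * p +
      ((a == a0)%:R * w v)%:E * (1 - p)) <=
    \esum_(a in [set: move])
      ((branch center a)%:E * reach_prob A (a :: center : N)).
  apply: le_esum => a _; have [->|aa0] := eqVneq a a0.
    rewrite ba0 mul1r reach_prob1// mule1 -(fineK pfin) -EFinB -!EFinM -EFinD.
    by rewrite lee_fin mulrBr mulr1 addrC subrK.
  rewrite mul0r mul0e adde0.
  case: a aa0 => [u|[s|u]] _; rewrite ?mul0e//.
  rewrite lee_wpmul2l ?lee_fin ?branch_ge0//; exact: reach_prob_leaf.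
have p0 : 0 <= p := reach_prob_ge0 _ _.
have p1 : 0 <= 1 - p by rewrite sube_ge0 ?pfin// reach_prob_le1.
move: le1; rewrite esumD; last 2 first.
- by move=> a _; rewrite mule_ge0// lee_fin branch_ge0.
- by move=> a _; rewrite mule_ge0// lee_fin mulr_ge0// ltW.
rewrite [X in _ + X](esum_single (t := a0)); last 2 first.
- by move=> a; rewrite mule_ge0// lee_fin mulr_ge0// ltW.
- by move=> a /negPf ->; rewrite mul0r mul0e.
rewrite eqxx mul1r.
under eq_esum do rewrite muleC.
rewrite -[X in esum _ (fun=> X * _)](fineK pfin) esumZl; last 2 first.
- by rewrite -lee_fin fineK.
- by move=> a; rewrite lee_fin branch_ge0.
rewrite fineK// muleC => le1.
have := le_trans (leeD2r _ le1) sup.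
rewrite [drop _ _]/= -/center -/p (stayE branch_ge0 branch_sum).
have : \esum_(a in [set: move]) (branch center a)%:E \is a fin_num.
  rewrite ge0_fin_numE; last by apply: esum_ge0 => a _; rewrite lee_fin branch_ge0.
  by rewrite (le_lt_trans (branch_sum _))// ltry.
move=> /fineK <-; move: (fine (esum _ _)) => b.
rewrite -(fineK pfin) -!EFinB -!EFinM -!EFinD !lee_fin.
have := w_gt0 v; move: (w v) (fine p) => wv r wv0 h.
have : (wv * (1 - r) <= 0)%R by lra.
by rewrite pmulr_rle0// subr_le0.
Qed.

Context (terminal_t : terminal phi t).

(** A witness for [Finally] is reachable from [t], hence occurs as a leaf and is met with
    probability one. A body invariant somewhere above [t] is, by terminality, invariant at [t]
    itself and so holds at every node of the star. *)
Lemma in_star_sat psi (z : N) : admissible psi -> in_star z ->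
  sat psi (at_state z) -> sat psi z.
Proof.
elim: psi z => [a|a|f ihf g ihg|f ihf g ihg|c q f ih|[] q f ih] z ad sz //=.
- have [adf adg] := admissible_And ad.
  by move=> [satf satg]; split; [exact: ihf|exact: ihg].
- by case: ad.
- rewrite -!/(reach_prob _ _) => cq; apply: compare_mono cq _.
  have [|] := ltP 0 (reach_prob (sat f) (at_state z)); last first.
    by move=> /le_trans; apply; exact: reach_prob_ge0.
  move=> /reach_prob_gt0[v zv fv]; apply: le_trans (reach_prob_le1 _ _) _.
  have tv := reach_trans (in_star_reach sz) zv.
  apply: (star_reach_prob1 tv _ sz); apply: ih => //.
  by right; exists v.
- have [[q1 _] Tpsi _] := ad.
  rewrite -/(sat (Globally Ge q f) _) => /(sat_globally1 _ _ q1) inv.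
  apply/(sat_globally1 _ _ q1) => y zy.
  have [Tf stable] := Tpsi _ terminal_t.
  have invt := stable _ (in_star_reach sz) inv.
  have sy := reach_closed in_star_closed zy sz.
  apply: ih => //; first exact: admissible_Globally ad.
  by apply: invt; exact: in_star_reach.
- by case: ad.
Qed.

End star.

(** Tree moves follow paths of [M], and self-loops change nothing. The return from a leaf to its
    centre may have no path of [M] behind it; there terminality of the centre supplies the
    invariant. *)
Lemma invariant_closed f c q (x y : N) : admissible (Globally c q f) -> ok x ->
  invariant f (at_state x) -> (0 < trans x y)%R ->
  ok y /\ invariant f (at_state y).
Proof.
move=> [_ Tf _] okx invx xy; split; first exact: valid_closed okx xy.
move: xy => /tree_trans_gt0[[a -> ca]|->].
  by apply: invariant_reach invx; apply: valid_reach; rewrite /= okx.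
case: x okx invx => [|[u|[t|v]] x] okx invx //=; rewrite drop0.
have [t [x' [xE _ tv]]] := valid_leaf okx; rewrite xE in okx *.
have /andP[/valid_center[_ tE] _] := okx.
have [_ stable] : terminal (Globally c q f) t.
  by apply: Tf; rewrite tE; exact: terminal_term.
exact: stable tv invx.
Qed.

Lemma star_node_sat psi (x : N) : hasG phi -> admissible psi -> ok x ->
  ~~ is_tree x -> sat psi (at_state x) -> sat psi x.
Proof.
move=> G ad; case: x => [//|[//|[t|v]] x] okx _.
  have [_ tE] := valid_center okx.
  apply: (in_star_sat (t := t) (x := x)) => //; last by left.
  by rewrite tE; exact: terminal_term.
have [t [x' [xE _ tv]]] := valid_leaf okx; rewrite xE in okx *.
have /andP[/valid_center[_ tE] _] := okx.
apply: (in_star_sat (t := t) (x := x')) => //; last by right; exists v.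
by rewrite tE; exact: terminal_term.
Qed.

(* A run leaves the tree part almost surely, and the stars it enters see every
   nontrivial invariant [F] goal with probability one. *)
Lemma tree_invariant_finally c q f (x : N) : hasG phi ->
  admissible (Finally c q f) -> ~ compare (R := R) c q 0 ->
  ok x -> is_tree x -> invariant (Finally c q f) (at_state x) ->
  1 <= reach_prob (sat f) x.
Proof.
move=> G [Ff Tf Gf] nc0.
(* Tree children owe strictly less, and the only other child is a centre, so induction on the weight
   of the goals ends in stars. *)
have [n] := ubnP (goals_depth (goals x)); elim: n x => // n ih x.
rewrite ltnS => lt_n okx tx inv; apply: le_trans (reach_prob_branch _ _).
rewrite -(branch_tree_sum tx); apply: le_esum => a _.
have [b0|b0] := ltP 0%R (branch x a); last first.
  have /eqP -> : branch x a == 0%R by rewrite eq_le b0 branch_ge0.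
  by rewrite mul0e.
have oka : ok (a :: x) by rewrite /= okx.
have inva := invariant_reach (valid_reach oka) inv.
rewrite -[leLHS]mule1 lee_wpmul2l ?lee_fin ?branch_ge0//.
case: a b0 oka inva => [u|[t|v]] b0 oka inva.
- have [_ _ lt] := valid_tree oka.
  by apply: ih => //; exact: leq_trans lt lt_n.
- have [_ tE] := valid_center oka.
  have /(compare_gt0 nc0 (reach_prob_ge0 _ _)) := inva _ (reach_refl _).
  move=> /reach_prob_gt0[v tv fv].
  apply: (star_reach_prob1 (t := t) (x := x) G tv); last by left.
  apply: (in_star_sat (t := t) (x := x)) => //; last by right; exists v.
  by rewrite tE; exact: terminal_term.
- by have [t [x' [xE _ _]]] := valid_leaf oka; rewrite xE in tx.
Qed.

(** This covers formulas below a [Globally]. A nested [Globally] makes its body invariant along all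
    transitions; the body then holds at tree nodes by induction and in stars by [star_node_sat]. *)
Lemma tree_invariant_sat psi (x : N) : hasG phi -> admissible psi ->
  ok x -> is_tree x -> invariant psi (at_state x) -> sat psi x.
Proof.
move=> G.
elim: psi x => [a|a|f ihf g ihg|f ihf g ihg|c q f ih|[] q f ih] x ad okx tx inv.
- exact: (inv _ (reach_refl _)).
- exact: (inv _ (reach_refl _)).
- have [adf adg] := admissible_And ad; split.
    by apply: ihf => // v /inv[].
  by apply: ihg => // v /inv[].
- by case: ad.
- rewrite /= -/(reach_prob _ _).
  (* A bound met by probability 0 is vacuous; any other one is met because the probability in the
     tree is 1. *)
  have [c0|nc0] := pselect (compare (R := R) c q 0).
    by apply: compare_mono c0 _; exact: reach_prob_ge0.
  apply: compare_mono (inv _ (reach_refl _)) _.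
  apply: le_trans (reach_prob_le1 _ _) _.
  exact: tree_invariant_finally G ad nc0 okx tx inv.
- have [[q1 _] _ _] := ad; apply/(sat_globally1 _ _ q1) => y xy.
  have invx : invariant f (at_state x).
    by have /(sat_globally1 _ _ q1) := inv _ (reach_refl _).
  have [oky invy] : ok y /\ invariant f (at_state y).
    apply: (reach_closed (K := fun y : N => ok y /\ invariant f (at_state y)) _ xy).
      by move=> u v [oku invu]; exact: (invariant_closed ad).
    by split.
  have adf : admissible f := admissible_Globally G ad.
  have [ty|ty] := boolP (is_tree y); first exact: ih.
  by apply: star_node_sat => //; apply: invy; exact: reach_refl.
- by case: ad.
Qed.

(** A [Finally] outside [Globally] has its body among the goals, whose probabilities are assumed not
    to drop. A [Globally] true at the state is invariant from there on, and [tree_invariant_sat]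
    carries it to the node. *)
Lemma tree_local_sat psi (x : N) : admissible psi -> ok x -> is_tree x ->
  (forall f, f \in goals x ->
    reach_prob (sat f) (at_state x) <= reach_prob (sat f) x) ->
  {subset local_goals psi <= goals x} -> sat psi (at_state x) -> sat psi x.
Proof.
move=> + okx tx demand.
elim: psi => [a|a|f ihf g ihg|f ihf g ihg|c q f ih|c q f ih] ad sub //.
- have [adf adg] := admissible_And ad; move=> [satf satg]; split.
    by apply: ihf => // h hf; apply: sub; rewrite mem_cat hf.
  by apply: ihg => // h hg; apply: sub; rewrite mem_cat hg orbT.
- by case: ad.
- move=> cq; apply: compare_mono cq _.
  by apply: demand; apply: sub; rewrite mem_head.
- case: c ad sub => ad _; last by case: ad.
  have [[q1 _] _ Gpsi] := ad.
  move=> /(sat_globally1 _ _ q1) inv; apply: tree_invariant_sat => //.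
    exact: Gpsi.
  move=> v xv; apply/(sat_globally1 _ _ q1) => u vu.
  by apply: inv; exact: reach_trans xv vu.
Qed.

Lemma admissible_local_goals psi : admissible psi ->
  forall f, f \in local_goals psi -> admissible f.
Proof.
elim: psi => //= [f ihf g ihg|c q f _] ad h.
  have [adf adg] := admissible_And ad; rewrite mem_cat => /orP[].
    exact: ihf.
  exact: ihg.
by rewrite inE => /eqP ->.
Qed.

Lemma admissible_goals x f : admissible phi -> f \in goals x -> admissible f.
Proof.
move=> ad; elim: x f => [|a x ih] f /=; first exact: admissible_local_goals.
move=> /flattenP[_ /mapP[g gx ->]]; case: asboolP => _.
  exact/admissible_local_goals/ih.
by rewrite inE => /eqP ->; exact: ih.
Qed.

(** Induction on the weight of the goals. After a first hit at [u], either [f] fails there and is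
    still owed, or it holds and its own goals have been added, so that the node itself satisfies
    [f]. *)
Lemma tree_goals (x : N) f : admissible phi -> ok x -> is_tree x ->
  f \in goals x -> reach_prob (sat f) (at_state x) <= reach_prob (sat f) x.
Proof.
move=> ad; have [n] := ubnP (goals_depth (goals x)).
elim: n x f => // n ih x f; rewrite ltnS => lt_n okx tx fx.
have sub : sat f `<=` goal_set x by move=> u fu; exists f.
apply: le_trans (reach_prob_first_hit (at_state x) sub) _.
apply: le_trans (reach_prob_branch _ _).
rewrite (branch_tree_esum tx (h := fun a => reach_prob (sat f) (a :: x : N))).
  apply: le_trans (_ : _ <= \esum_(u in [set: M])
    ((first_hit (goal_set x) (at_state x) u)%:E *
     reach_prob (sat f) (inl u :: x : N))) _; last first.
    by rewrite leeDl// mule_ge0 ?lee_fin// reach_prob_ge0.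
  apply: le_esum => u _; set hit := first_hit _ _ _.
  have [hit0|hit0] := ltP 0%R hit; last first.
    have /eqP -> : hit == 0%R by rewrite eq_le hit0 first_hit_ge0.
    by rewrite !mul0e.
  have oku : ok (inl u :: x) by rewrite /= okx branch_tree.
  have [_ _ lt] := valid_tree oku.
  rewrite lee_wpmul2l ?lee_fin ?first_hit_ge0//.
  (* Used twice: for [f] when it is still owed, and as the assumption on goals in
     [tree_local_sat]. *)
  have ihu g : g \in goals (inl u :: x) ->
      reach_prob (sat g) u <= reach_prob (sat g) (inl u :: x : N).
    by move=> gu; apply: (ih (inl u :: x)) => //; exact: leq_trans lt lt_n.
  have [fu|fu] := pselect (sat f u); last first.
    by apply: ihu; exact: next_goals_nsat.
  rewrite (reach_prob1 (M := N)) ?reach_prob_le1//.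
  apply: tree_local_sat => //; first exact: admissible_goals ad fx.
  exact: next_goals_sat.
by move=> a; exact: reach_prob_ge0.
Qed.

Lemma star_tree_sat : FqG1 phi -> sat phi (init M) -> sat phi (init N).
Proof.
move=> Fphi sat0; have ad : admissible phi by [].
by apply: tree_local_sat => // f fx; exact: tree_goals.
Qed.

Lemma star_tree_model : FqG1 phi -> model M phi ->
  exists N' : markov_chain R AP, model N' phi /\
    exists2 h, (h <= formula_length phi)%N & has_height N' h.
Proof.
move=> Fphi mod; exists (valid_chain up (fun x => label (at_state x))
  branch_ge0 branch_sum); split.
  by rewrite /model sat_restrict; exact: star_tree_sat.
by apply: valid_chain_height => x; exact: valid_size.
Qed.

End construction.

Theorem theorem5 (R : realType) (AP : finType) (phi : formula AP) :
  FqG1 phi -> satisfiable R phi ->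
  exists M : markov_chain R AP,
    model M phi /\ exists2 h : nat, (h <= formula_length phi)%N & has_height M h.
Proof.
move=> Fphi [M mod].
have /choice[term termP] s : exists t : M, reach s t /\ terminal phi t.
  by have [t] := terminal_exists phi s; exists t.
have [w w_gt0 w_sum] := @positive_weights R M.
exact: (@star_tree_model R AP M phi term w (fun s => (termP s).1)
  (fun s => (termP s).2)).
Qed.
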